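(* (a) For each fixed $y\in(0,1)$ and $q\in(1,\infty)$, the functions $p\mapsto\sin_{p,q}(y)$ and $p\mapsto\operatorname{tam}_{p,q}(y)$ are increasing on $(1,\infty)$, while the functions $p\mapsto\sinh_{p,q}(y)$, $p\mapsto\cosh_{p,q}(y)$ and $p\mapsto\operatorname{tamh}_{p,q}(y)$ are decreasing on $(1,\infty)$. (b) For each fixed $y\in(0,1)$ and $p\in(1,\infty)$, the functions $q\mapsto\sin_{p,q}(y)$ and $q\mapsto\operatorname{tamh}_{p,q}(y)$ are increasing on $(1,\infty)$. (c) The functions $p\mapsto\cos_{p,q}(y)$, $q\mapsto\cos_{p,q}(y)$, $q\mapsto\cosh_{p,q}(y)$, $q\mapsto\operatorname{tam}_{p,q}(y)$ and $q\mapsto\sinh_{p,q}(y)$ are in general not monotonic: for each of these five functions there exist a value $y>0$ and a value in $(1,\infty)$ of the other (fixed) parameter such that the function, considered on the set of those values of the varying parameter in $(1,\infty)$ for which $y$ lies in the domain of the function, is not monotonic.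
   Context: Let $p,q>1$. $\arcsin_{p,q}(x)=\int_0^x (1-t^q)^{-1/p}\,dt$ for $x\in[0,1]$; $\pi_{p,q}/2=\arcsin_{p,q}(1)$; $\sin_{p,q}:[0,\pi_{p,q}/2]\to[0,1]$ is the inverse of $\arcsin_{p,q}$; $\cos_{p,q}(y)=\frac{d}{dy}\sin_{p,q}(y)=(1-\sin_{p,q}^q(y))^{1/p}$ on $[0,\pi_{p,q}/2]$. $\operatorname{arcsinh}_{p,q}(x)=\int_0^x(1+t^q)^{-1/p}\,dt$ for $x\ge0$; $\hat\pi_{p,q}/2=\int_0^\infty(1+t^q)^{-1/p}\,dt\in(0,\infty]$; $\sinh_{p,q}:[0,\hat\pi_{p,q}/2)\to[0,\infty)$ is the inverse of $\operatorname{arcsinh}_{p,q}$; $\cosh_{p,q}(y)=\frac{d}{dy}\sinh_{p,q}(y)=(1+\sinh_{p,q}^q(y))^{1/p}$ on $[0,\hat\pi_{p,q}/2)$. $\operatorname{tam}_{p,q}(y)=\sin_{p,q}(y)/[\cos_{p,q}(y)]^{p/q}$ for $y\in[0,\pi_{p,q}/2)$; equivalently it is the inverse of $x\mapsto\int_0^x(1+t^q)^{-(1+1/q-1/p)}\,dt$, $x\ge0$. $\operatorname{tamh}_{p,q}(y)=\sinh_{p,q}(y)/[\cosh_{p,q}(y)]^{p/q}$ for $y\in[0,\hat\pi_{p,q}/2)$; equivalently it is the inverse of $x\mapsto\int_0^x(1-t^q)^{-(1+1/q-1/p)}\,dt$, $0\le x<1$. One has $\pi_{p,q}/2>1$ and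 $\hat\pi_{p,q}/2>1$ for all $p,q>1$, so for $y\in(0,1)$ all these functions are defined for all $p,q>1$. *)

(* Defs.v *)
From HB Require Import structures.
From mathcomp Require Import all_boot all_order all_algebra.
From mathcomp Require Import all_classical all_reals all_analysis.

Set Implicit Arguments.
Unset Strict Implicit.
Unset Printing Implicit Defensive.

Import Order.TTheory GRing.Theory Num.Theory.
Import numFieldNormedType.Exports.

Local Open Scope classical_set_scope.
Local Open Scope ring_scope.

(* Derivative of f at y relative to A: the difference quotient is taken only at
   points of A, hence it is one-sided at an endpoint of an interval A. *)
Definition derive_in (R : realType) (A : set R) (f : R -> R) (y : R) : R :=
  lim ((f z - f y) / (z - y) @[z --> within A y^']).

(* Weak inequalities on both sides: the negation says that f is neither
   nondecreasing nor nonincreasing on D. *)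
Definition monotonic_on (R : realType) (D : set R) (f : R -> R) : Prop :=
  {in D &, {homo f : x y / x <= y}} \/ {in D &, {homo f : x y /~ x <= y}}.

Section GeneralizedTrigonometricFunctions.
Variables (R : realType) (p q : R).
Local Notation mu := (@lebesgue_measure R).

(* For x = 1 and p > 1 the integrand is singular at t = 1, where powR makes it 0;
   this single point is Lebesgue-negligible. *)
Definition arcsin_pq (x : R) : R :=
  \int[mu]_(t in `[0, x]) (1 - t `^ q) `^ (- p^-1).

Definition pi_pq : R := 2 * arcsin_pq 1.

Definition sin_dom : set R := `[0, pi_pq / 2].

(* The inverses below take the irrelevant value 0 outside their domains. *)
Definition sin_pq : R -> R := 'pinv_(fun=> 0) `[0, 1] arcsin_pq.

Definition cos_pq : R -> R := derive_in sin_dom sin_pq.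

Definition tam_dom : set R := `[0, pi_pq / 2[.

Definition tam_pq (y : R) : R := sin_pq y / cos_pq y `^ (p / q).

Definition arcsinh_pq (x : R) : R :=
  \int[mu]_(t in `[0, x]) (1 + t `^ q) `^ (- p^-1).

Definition hpi_pq : \bar R :=
  (2%:E * \int[mu]_(t in `[0%R, +oo[) ((1 + t `^ q) `^ (- p^-1))%:E)%E.

Definition sinh_dom : set R := [set y | 0 <= y /\ (y%:E < hpi_pq / 2%:E)%E].

Definition sinh_pq : R -> R := 'pinv_(fun=> 0) `[0, +oo[ arcsinh_pq.

Definition cosh_pq : R -> R := derive_in sinh_dom sinh_pq.

Definition tamh_pq (y : R) : R := sinh_pq y / cosh_pq y `^ (p / q).

End GeneralizedTrigonometricFunctions.

(* Main.v *)
Require Import Defs.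
From mathcomp Require Import all_boot all_order all_algebra.
From mathcomp Require Import all_classical all_reals all_analysis.
From mathcomp Require Import measurable_realfun ring lra.
Set Implicit Arguments.
Unset Strict Implicit.
Unset Printing Implicit Defensive.

Import Order.TTheory GRing.Theory Num.Theory.
Import numFieldNormedType.Exports.
Local Open Scope classical_set_scope.
Local Open Scope ring_scope.

(** Each of sin and sinh is the inverse of a primitive, on [0, b], of an explicit
    positive density. If one density lies pointwise above another, its primitive
    is larger and the inverse of the primitive is smaller
    (primitive_inverse_lt). The density (1 - t^q)^(-1/p) decreases in p and in
    q, so sin increases in both; (1 + t^q)^(-1/p) increases in p, so sinh
    decreases in p. With q fixed, tam, cosh and tamh are increasing functions of
    sin, respectively sinh (for cosh the exponent 1/p decreases as well), which
    settles the dependence on p (tam_p_lt, cosh_p_gt, tamh_p_gt).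

    For the dependence of tamh on q the integral is rewritten in the variable
    w = tamh, where the density becomes (1 - w^q)^(-(1 + 1/q - 1/p)) on [0, 1[
    (primitive_arcsinh_of_tamh). It decreases in q, so tamh increases
    (tamh_q_lt). The same density is at least 1, which shows that every y in
    ]0, 1[ is a value of arcsinh (arcsinh_exists); that it is a value of arcsin
    holds because the density of arcsin is at least 1.

    Each of the five failures of monotonicity is shown by three values of the
    varying parameter at which the function goes up and then down, or down and
    then up (not_monotonic_peak, not_monotonic_dip). The third parameter value
    is always large and y is close to 1. There the density of arcsin or arcsinh
    is about 1 on [0, 1[ and changes abruptly at 1, so that the value of sin or
    sinh may be prescribed near or beyond 1 (for cos, tam and sinh) or is at
    most 1 (for cosh). The values at the other two parameters are bounded by
    comparing the density with one that has an elementary primitive. *)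

(** * Primitives and their inverses *)

Section Primitives.
Variable R : realType.
Implicit Types (F g : R -> R) (b x y z : R).

(** The derivative is prescribed only inside ]0, b[: the arcsine integrand is
    singular at 1, and a power t `^ q has no two-sided derivative at 0. The
    equality F 0 = 0 together with continuity pins F down as the integral. *)
Definition primitive b F g : Prop :=
  [/\ F 0 = 0, {within `[0, b], continuous F} &
      forall x, 0 < x < b -> is_derive x 1 F (g x)].

Lemma primitive_of_derive b F g : F 0 = 0 ->
  (forall x, 0 <= x <= b -> is_derive x 1 F (g x)) -> primitive b F g.
Proof.
move=> F0 dF; split=> //.
  apply: derivable_within_continuous => x; rewrite in_itv/= => xb.
  by have [] := dF x xb.
by move=> x /andP[x0 xb]; apply: dF; rewrite !ltW.
Qed.

Lemma primitive_le b b' F g : b' <= b -> primitive b F g -> primitive b' F g.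
Proof.
move=> bb [F0 cF dF]; split=> //; last first.
  by move=> x /andP[x0 xb]; apply: dF; rewrite x0 (lt_le_trans xb).
apply: continuous_subspaceW cF => x /=; rewrite !in_itv/= => /andP[-> xb].
exact: le_trans bb.
Qed.

(** The comparisons and estimates of primitives below are all the mean value
    theorem applied to F2 - F1. *)
Lemma primitive_mvt b F1 g1 F2 g2 x y :
  primitive b F1 g1 -> primitive b F2 g2 -> 0 <= x -> x < y -> y <= b ->
  exists2 c, x < c < y &
    (F2 y - F2 x) - (F1 y - F1 x) = (g2 c - g1 c) * (y - x).
Proof.
move=> [_ c1 d1] [_ c2 d2] x0 xy yb.
have sub : `[x, y] `<=` `[0, b].
  move=> z /=; rewrite !in_itv/= => /andP[xz zy].
  by rewrite (le_trans x0 xz) (le_trans zy yb).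
have in0 z : z \in `]x, y[ -> 0 < z < b.
  by rewrite in_itv/= => /andP[xz zy]; rewrite (le_lt_trans x0 xz) (lt_le_trans zy yb).
have [||c cxy E] := @MVT R (F2 \- F1) (fun z => g2 z - g1 z) x y xy.
- by move=> z /in0 zb; apply: is_deriveB; [exact: d2|exact: d1].
- apply: (continuous_subspaceW sub).
  by move=> z; apply: cvgB; [exact: c2|exact: c1].
exists c; first by move: cxy; rewrite in_itv.
by move: E => /= <-; ring.
Qed.

Lemma primitive_lt b F1 g1 F2 g2 x y :
  primitive b F1 g1 -> primitive b F2 g2 -> 0 <= x -> x < y -> y <= b ->
  (forall z, x < z < y -> g1 z < g2 z) -> F1 y - F1 x < F2 y - F2 x.
Proof.
move=> p1 p2 x0 xy yb gg; rewrite -subr_gt0.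
have [c /gg cxy ->] := primitive_mvt p1 p2 x0 xy yb.
by rewrite mulr_gt0 ?subr_gt0.
Qed.

Lemma primitive_leq b F1 g1 F2 g2 x y :
  primitive b F1 g1 -> primitive b F2 g2 -> 0 <= x -> x <= y -> y <= b ->
  (forall z, x < z < y -> g1 z <= g2 z) -> F1 y - F1 x <= F2 y - F2 x.
Proof.
move=> p1 p2 x0; rewrite le_eqVlt => /predU1P[<- _ _|xy yb gg].
  by rewrite !subrr.
rewrite -subr_ge0.
have [c /gg cxy ->] := primitive_mvt p1 p2 x0 xy yb.
by rewrite mulr_ge0// subr_ge0// ltW.
Qed.

Lemma primitive_leq0 b F1 g1 F2 g2 :
  primitive b F1 g1 -> primitive b F2 g2 -> 0 <= b ->
  (forall z, 0 < z < b -> g1 z <= g2 z) -> F1 b <= F2 b.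
Proof.
move=> p1 p2 b0 gg; have [F10 _ _] := p1; have [F20 _ _] := p2.
by have := primitive_leq p1 p2 (lexx 0) b0 (lexx b) gg; rewrite F10 F20 !subr0.
Qed.

Lemma primitive_lt0 b F1 g1 F2 g2 :
  primitive b F1 g1 -> primitive b F2 g2 -> 0 < b ->
  (forall z, 0 < z < b -> g1 z < g2 z) -> F1 b < F2 b.
Proof.
move=> p1 p2 b0 gg; have [F10 _ _] := p1; have [F20 _ _] := p2.
by have := primitive_lt p1 p2 (lexx 0) b0 (lexx b) gg; rewrite F10 F20 !subr0.
Qed.

Lemma primitive_cst0 b : primitive b (cst 0) (cst 0).
Proof. by apply: primitive_of_derive => // x _; exact: is_derive_cst. Qed.

Lemma primitive_id b : primitive b id (cst 1).
Proof. by apply: primitive_of_derive => // x _; exact: is_derive_id. Qed.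

Lemma primitive_increasing b F g x y :
  primitive b F g -> (forall z, 0 < z < b -> 0 < g z) ->
  0 <= x -> x < y -> y <= b -> F x < F y.
Proof.
move=> pF g0 x0 xy yb; rewrite -subr_gt0.
have := primitive_lt (primitive_cst0 b) pF x0 xy yb; rewrite subrr; apply.
move=> z /andP[xz zy]; apply: g0.
by rewrite (le_lt_trans x0 xz) (lt_le_trans zy yb).
Qed.

(** A pointwise larger density makes the primitive larger, hence its inverse
    smaller: if x2 were at most x1, then F2 x2 would be at most F2 x1, which is
    less than F1 x1. *)
Lemma primitive_inverse_lt F1 g1 F2 g2 x1 x2 :
  primitive x1 F1 g1 -> primitive x1 F2 g2 ->
  (forall z, 0 < z < x1 -> 0 <= g2 z < g1 z) ->
  0 < x1 -> 0 <= x2 -> F1 x1 = F2 x2 -> x1 < x2.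
Proof.
move=> pF1 pF2 gg x10 x20 E; rewrite ltNge; apply/negP => x21.
suff : F2 x2 < F1 x1 by rewrite E ltxx.
apply: (@le_lt_trans _ _ (F2 x1)); last first.
  by apply: (primitive_lt0 pF2 pF1 x10) => z /gg /andP[].
rewrite -subr_ge0.
have := primitive_leq (primitive_cst0 x1) pF2 x20 x21 (lexx x1).
rewrite subrr; apply => z /andP[xz zx].
by have /gg /andP[] : 0 < z < x1 by rewrite zx (le_lt_trans x20).
Qed.

Lemma primitive_ivt b F g y : primitive b F g -> 0 < y < F b -> 0 < b ->
  exists2 x, 0 < x < b & F x = y.
Proof.
move=> [F0 cF _] /andP[y0 yF] b0.
have [|c] := IVT (ltW b0) cF (v := y).
  rewrite F0 ge_min le_max (ltW y0)/= (ltW yF) orbT //.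
rewrite in_itv/= => /andP[c0 cb] Fc; exists c => //.
rewrite !lt_neqAle c0 cb !andbT; apply/andP; split; apply/eqP => E.
  by move: y0; rewrite -Fc -E F0 ltxx.
by move: yF; rewrite -Fc E ltxx.
Qed.

(** The default value of the partial inverse is irrelevant near F x, since F is
    injective on the whole of A and A contains a neighbourhood of x. *)
Lemma primitive_inverse b F g (A : set R) x :
  primitive b F g -> (forall z, 0 < z < b -> 0 < g z) ->
  `[0, b]%classic `<=` A -> {in A &, injective F} -> 0 < x < b ->
  let G := 'pinv_(fun=> 0) A F in
  G (F x) = x /\ is_derive (F x) 1 G (g x)^-1.
Proof.
move=> pF g0 bA injF xb G.
have GK z : 0 <= z <= b -> G (F z) = z.
  by move=> zb; apply: pinvKV => //; rewrite inE; apply: bA; rewrite /= in_itv.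
have [x0 xb'] := andP xb.
have nbx : \forall z \near x, 0 < z < b.
  by near=> z; apply/andP; split; near: z; [exact: lt_nbhsr|exact: lt_nbhsl].
split; first by apply: GK; rewrite !ltW.
apply: is_derive_inverse.
- by apply: filterS nbx => z /andP[z0 zb]; apply: GK; rewrite !ltW.
- apply: filterS nbx => z zb; have [_ _ /(_ z zb) [d _]] := pF.
  by apply: differentiable_continuous; apply/derivable1_diffP.
- by have [_ _] := pF; apply.
- by rewrite gt_eqF// g0.
Unshelve. all: by end_near. Qed.

(** At an interior point the filter of punctured neighbourhoods within A is the
    full punctured filter, so the relative derivative is the usual one. *)
Lemma derive_in_interior (A : set R) (f : R -> R) (y l : R) :
  nbhs y A -> is_derive y 1 f l -> derive_in A f y = l.
Proof.
move=> yA /is_derive1_caratheodory [g [fE cg gy]].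
rewrite /derive_in.
have W : within A y^' = y^'.
  apply/seteqP; split => P; rewrite /within/=; last first.
    by apply: filterS => z.
  move=> AP; near=> z.
  have : A z -> P z by near: z.
  apply; near: z; rewrite /= /dnbhs /within/=.
  by apply: filterS yA => z.
rewrite W; apply/cvg_lim => //.
rewrite -gy.
have cg' : g z @[z --> y^'] --> g y by apply: cvg_within_filter.
apply: cvg_trans cg'; apply: near_eq_cvg; near=> z.
rewrite fE mulfK// subr_eq0; near: z; exact: nbhs_dnbhs_neq.
Unshelve. all: by end_near. Qed.

End Primitives.

(** * The densities and their integrability *)

Section Integrals.
Variable R : realType.
Implicit Types (g : R -> R) (a b p q s t x y z : R).
Local Notation mu := (@lebesgue_measure R).

Lemma primitive_integral b g : 0 <= b ->
  mu.-integrable `[0, b] (EFin \o g) ->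
  (forall x, 0 < x < b -> {for x, continuous g}) ->
  primitive b (fun x => \int[mu]_(t in `[0, x]) g t) g.
Proof.
move=> b0 ig cg; split.
- by rewrite set_itv1 Rintegral_set1.
- exact: parameterized_integral_continuous b0 ig.
- move=> x /[dup] /cg cgx /andP[x0 xb].
  have [dF dE] := continuous_FTC1_closed xb ig x0 cgx.
  by rewrite -dE derive1E; exact/derivableP.
Qed.

Definition arcsin_density p q t : R := (1 - t `^ q) `^ (- p^-1).
Definition arcsinh_density p q t : R := (1 + t `^ q) `^ (- p^-1).

Lemma continuous_powR q x : 0 < x -> {for x, continuous (fun t : R => t `^ q)}.
Proof.
move=> x0; have [d _] := is_derive1_powR q x0.
by apply: differentiable_continuous; apply/derivable1_diffP.
Qed.

Lemma continuous_powR_comp (f : R -> R) q x : 0 < f x ->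
  {for x, continuous f} -> {for x, continuous (fun t : R => f t `^ q)}.
Proof.
move=> fx cf; exact: (continuous_comp cf (continuous_powR (q := q) fx)).
Qed.

Lemma powR_lt1 q x : 0 < q -> 0 <= x < 1 -> x `^ q < 1.
Proof.
move=> q0 /andP[x0 x1]; have := gt0_ltr_powR q0 (x := x) (y := 1).
by rewrite !nnegrE powR1; apply.
Qed.

Lemma powR_le1 q x : 0 <= q -> 0 <= x <= 1 -> x `^ q <= 1.
Proof.
move=> q0 /andP[x0 x1]; have := ge0_ler_powR q0 (x := x) (y := 1).
by rewrite !nnegrE powR1; apply.
Qed.

Lemma powR_leN q x y : 0 <= q -> 0 < x -> x <= y -> y `^ (- q) <= x `^ (- q).
Proof.
move=> q0 x0 xy; have y0 := lt_le_trans x0 xy.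
rewrite !powRN lef_pV2 ?posrE ?powR_gt0//.
by apply: ge0_ler_powR; rewrite ?nnegrE// ltW.
Qed.

Lemma powR_ltN q x y : 0 < q -> 0 < x -> x < y -> y `^ (- q) < x `^ (- q).
Proof.
move=> q0 x0 xy; have y0 := lt_trans x0 xy.
rewrite !powRN ltf_pV2 ?posrE ?powR_gt0//.
by apply: gt0_ltr_powR; rewrite ?nnegrE// ltW.
Qed.

Lemma measurable_arcsinh_density p q (A : set R) : measurable_fun A (arcsinh_density p q).
Proof.
apply: (@measurable_funS _ _ _ _ setT) => //.
apply: (measurableT_comp (measurable_powR (- p^-1))).
by apply: measurable_funD => //; exact: measurable_powR.
Qed.

Lemma measurable_arcsin_density p q (A : set R) : measurable_fun A (arcsin_density p q).
Proof.
apply: (@measurable_funS _ _ _ _ setT) => //.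
apply: (measurableT_comp (measurable_powR (- p^-1))).
by apply: measurable_funB => //; exact: measurable_powR.
Qed.

Lemma integrable_bounded_itv b M g : measurable_fun `[0, b] g ->
  (forall x, 0 <= x <= b -> 0 <= g x <= M) ->
  mu.-integrable `[0, b] (EFin \o g).
Proof.
move=> mg gM; apply: measurable_bounded_integrable => //.
  rewrite /= lebesgue_measure_itv/=; case: ifP => _; last exact: ltry.
  by rewrite -EFinB ltry.
exists M; split; first exact: num_real.
move=> N MN x /=; rewrite in_itv/= => /gM /andP[g0 gxM].
by rewrite ger0_norm// (le_trans gxM)// ltW.
Qed.

Lemma arcsinh_density_gt0 p q t : 0 < arcsinh_density p q t.
Proof. by rewrite powR_gt0// ltr_pwDl// powR_ge0. Qed.

Lemma arcsinh_density_le1 p q t : 0 < p -> arcsinh_density p q t <= 1.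
Proof.
move=> p0; have : 1 <= 1 + t `^ q by rewrite lerDl powR_ge0.
move=> /ler_powR /(_ (- p^-1) 0); rewrite powRr0; apply.
by rewrite oppr_le0 invr_ge0 ltW.
Qed.

Lemma primitive_arcsinh b p q : 0 < p -> 0 <= b ->
  primitive b (arcsinh_pq p q) (arcsinh_density p q).
Proof.
move=> p0 b0; apply: primitive_integral => //.
  apply: (@integrable_bounded_itv b 1); first exact: measurable_arcsinh_density.
  by move=> x _; rewrite arcsinh_density_le1// ltW// arcsinh_density_gt0.
move=> x /andP[x0 _]; apply: continuous_powR_comp.
  by rewrite ltr_pwDl// powR_ge0.
apply: cvgD; first exact: cvg_cst.
exact: continuous_powR.
Qed.

Lemma arcsin_density_base_gt0 q t : 0 < q -> 0 <= t < 1 -> 0 < 1 - t `^ q.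
Proof. by move=> q0 t01; rewrite subr_gt0 powR_lt1. Qed.

Lemma arcsin_density_gt0 p q t : 0 < q -> 0 <= t < 1 -> 0 < arcsin_density p q t.
Proof. by move=> q0 t01; rewrite powR_gt0// arcsin_density_base_gt0. Qed.

Lemma arcsin_density_ge0 p q t : 0 <= arcsin_density p q t.
Proof. exact: powR_ge0. Qed.

Lemma arcsin_density_le p q s t : 0 < p -> 0 < q -> 0 <= s -> s <= t -> t < 1 ->
  arcsin_density p q s <= arcsin_density p q t.
Proof.
move=> p0 q0 s0 st t1; apply: powR_leN.
- by rewrite invr_ge0 ltW.
- by apply: arcsin_density_base_gt0 => //; rewrite (le_trans s0 st).
- rewrite lerD2l lerN2; apply: ge0_ler_powR => //; rewrite ?nnegrE//.
    exact: ltW.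
  exact: le_trans st.
Qed.

Lemma continuous_arcsin_density p q x : 0 < q -> 0 < x < 1 ->
  {for x, continuous (arcsin_density p q)}.
Proof.
move=> q0 /andP[x0 x1]; apply: continuous_powR_comp.
  by apply: arcsin_density_base_gt0 => //; rewrite ltW.
apply: cvgB; first exact: cvg_cst.
exact: continuous_powR.
Qed.

Lemma integrable_arcsin_density_lt1 b p q : 0 < p -> 0 < q -> 0 <= b < 1 ->
  mu.-integrable `[0, b] (EFin \o arcsin_density p q).
Proof.
move=> p0 q0 /andP[b0 b1].
apply: (@integrable_bounded_itv b (arcsin_density p q b)).
  exact: measurable_arcsin_density.
by move=> x /andP[x0 xb]; rewrite arcsin_density_ge0 arcsin_density_le.
Qed.

Lemma primitive_arcsin_lt1 b p q : 0 < p -> 0 < q -> 0 <= b < 1 ->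
  primitive b (arcsin_pq p q) (arcsin_density p q).
Proof.
move=> p0 q0 /andP[b0 b1]; apply: primitive_integral => //.
  by apply: integrable_arcsin_density_lt1 => //; rewrite b0.
by move=> x /andP[x0 xb]; apply: continuous_arcsin_density; rewrite ?x0 ?(lt_trans xb).
Qed.

Lemma is_derive_pow1B a t : t < 1 ->
  is_derive t 1 (fun x : R => - (1 - x) `^ a) (a * (1 - t) `^ (a - 1)).
Proof.
move=> t1; have t0 : 0 < 1 - t by rewrite subr_gt0.
have d1 : is_derive t 1 (fun x : R => 1 - x) (-1).
  have := is_deriveB (is_derive_cst (1 : R) t 1) (is_derive_id t 1).
  by rewrite sub0r.
have d2 := is_derive1_powR a t0.
have d3 := is_derive1_comp (f := fun u : R => u `^ a) (g := fun x : R => 1 - x) d2 d1.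
have := is_deriveN d3.
by rewrite mulrN1 opprK.
Qed.

(** Since q is at least 1, t `^ q is at most t, and (1 - t) `^ (- p^-1) has an
    elementary primitive. That primitive is bounded on [0, 1[, which gives the
    integrability of the singular density. *)
Lemma arcsin_le_pow b p q : 1 < p -> 1 <= q -> 0 <= b < 1 ->
  arcsin_pq p q b <= (1 - p^-1)^-1 * (1 - (1 - b) `^ (1 - p^-1)).
Proof.
move=> p1 q1 /andP[b0 b1].
have p0 : 0 < p by rewrite (lt_trans _ p1).
have q0 : 0 < q by rewrite (lt_le_trans _ q1).
set a := 1 - p^-1.
have a0 : 0 < a by rewrite subr_gt0 invf_lt1.
set P := fun x : R => a^-1 * (1 - (1 - x) `^ a).
have pP : primitive b P (fun x => (1 - x) `^ (- p^-1)).
  apply: primitive_of_derive; first by rewrite /P subr0 powR1 subrr mulr0.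
  move=> x /andP[x0 xb]; have x1 := le_lt_trans xb b1.
  have d := is_derive_pow1B a x1.
  have := is_deriveM (is_derive_cst (a^-1 : R) x 1)
    (is_deriveD (is_derive_cst (1 : R) x 1) d).
  rewrite scaler0 addr0 add0r /GRing.scale/= mulrA mulVf ?gt_eqF// mul1r.
  by rewrite /a addrAC subrr add0r.
apply: (primitive_leq0 (primitive_arcsin_lt1 p0 q0 _) pP) => //.
  by rewrite b0.
move=> z /andP[z0 zb]; have z1 := lt_trans zb b1.
apply: powR_leN.
- by rewrite invr_ge0 ltW.
- by rewrite subr_gt0.
- rewrite lerD2l lerN2; apply: ge1r_powR => //; by rewrite z0 ltW.
Qed.

End Integrals.

Section Inverses.
Variable R : realType.
Implicit Types (g : R -> R) (a b p q s t x y z w : R).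
Local Notation mu := (@lebesgue_measure R).

(** Monotone convergence along [0, 1 - 1/(n+1)]: the integrals over these
    intervals stay below the bound of the preceding estimate. Integrability is
    needed up to the endpoint 1, for otherwise the real-valued integral defining
    pi_pq would be the default value 0. *)
Lemma integrable_arcsin_density p q : 1 < p -> 1 <= q ->
  mu.-integrable `[0, 1] (EFin \o arcsin_density p q).
Proof.
move=> p1 q1.
have p0 : 0 < p by rewrite (lt_trans _ p1).
have q0 : 0 < q by rewrite (lt_le_trans _ q1).
have a0 : 0 < 1 - p^-1 by rewrite subr_gt0 invf_lt1.
pose c (n : nat) : R := 1 - n.+1%:R^-1.
have c01 n : 0 <= c n < 1.
  rewrite /c subr_ge0 invf_le1// ler1n/=.
  by rewrite ltrBlDr ltrDl invr_gt0.
have nc (m n : nat) : (m <= n)%N -> c m <= c n.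
  by move=> mn; rewrite /c lerD2l lerN2 lef_pV2 ?posrE// ler_nat.
pose F (n : nat) : set R := `[0, c n]%classic.
have UF : \bigcup_n F n = `[0, 1[%classic.
  apply/seteqP; split => [x [n _]|x]; rewrite /F /= !in_itv/=.
    by move=> /andP[-> xc]; have /andP[_] := c01 n; exact: le_lt_trans.
  move=> /andP[x0 x1]; have x1' : 0 < 1 - x by rewrite subr_gt0.
  have [n nx] : exists n : nat, (1 - x)^-1 < n.+1%:R.
    exists (Num.bound (1 - x)^-1).
    apply: (lt_le_trans (archi_boundP _)); first by rewrite invr_ge0 ltW.
    by rewrite ler_nat.
  exists n => //; rewrite /= in_itv/= x0/= /c lerBrDr -lerBrDl.
  by rewrite -[leRHS]invrK lef_pV2 ?posrE ?invr_gt0// ltW.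
have mS (A : set R) : measurable_fun A (EFin \o arcsin_density p q).
  by apply/measurable_EFinP; exact: measurable_arcsin_density.
apply/integrableP; split; first exact: mS.
under eq_integral => x _ do rewrite /= ger0_norm ?arcsin_density_ge0//.
rewrite -[X in (X < _)%E](@integral_itv_bndo_bndc R (BLeft 0) 1); last exact: mS.
rewrite -UF.
have cv : (\int[mu]_(x in F i) (EFin \o arcsin_density p q) x)%E @[i --> \oo] -->
    (\int[mu]_(x in \bigcup_i F i) (EFin \o arcsin_density p q) x)%E.
  apply: ge0_nondecreasing_set_cvg_integral.
  - move=> m n mn; apply/subsetPset => x; rewrite /F /= !in_itv/=.
    by move=> /andP[-> xc]; exact: le_trans (nc _ _ mn).
  - by move=> i; exact: measurable_itv.
  - by move=> i; exact: mS.
  - by move=> i x _; rewrite /= lee_fin arcsin_density_ge0.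
rewrite -(cvg_lim _ cv)//.
have bnd i : (\int[mu]_(x in F i) (EFin \o arcsin_density p q) x <=
    ((1 - p^-1)^-1)%:E)%E.
  have ii := integrable_arcsin_density_lt1 p0 q0 (c01 i).
  rewrite -(@fineK _ (\int[mu]_(x in F i) _)%E); last exact: (integrable_fin_num _ ii).
  rewrite lee_fin; apply: le_trans (arcsin_le_pow p1 q1 (c01 i)) _.
  by rewrite ler_piMr ?gerBl ?powR_ge0// invr_ge0 ltW.
apply: (@le_lt_trans _ _ ((1 - p^-1)^-1)%:E); last exact: ltry.
apply: lime_le; last exact: nearW.
apply: ereal_nondecreasing_is_cvgn => m n mn.
apply: ge0_subset_integral => //.
- exact: measurable_itv.
- exact: measurable_itv.
- exact: mS.
- by move=> x _; rewrite /= lee_fin arcsin_density_ge0.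
- move=> x; rewrite /F /= !in_itv/=.
  by move=> /andP[-> xc]; exact: le_trans (nc _ _ mn).
Qed.

Lemma primitive_arcsin b p q : 1 < p -> 1 <= q -> 0 <= b <= 1 ->
  primitive b (arcsin_pq p q) (arcsin_density p q).
Proof.
move=> p1 q1 /andP[b0 b1].
apply: (primitive_le b1); apply: primitive_integral => //.
  exact: integrable_arcsin_density.
by move=> x x01; apply: continuous_arcsin_density => //; exact: lt_le_trans q1.
Qed.

End Inverses.

(** * The generalized functions at values of arcsin and arcsinh *)

Section InverseFunctions.
Variable R : realType.
Implicit Types (g F : R -> R) (a b p q s t x y z w : R).

Lemma gt1_lt_powR a s t : 1 < a -> s < t -> a `^ s < a `^ t.
Proof.
move=> a1 st; have a0 : 0 < a by exact: lt_trans a1.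
by rewrite /powR gt_eqF// ltr_expR ltr_pM2r// ln_gt0.
Qed.

Lemma lt1_lt_powR a s t : 0 < a < 1 -> s < t -> a `^ t < a `^ s.
Proof.
move=> /andP[a0 a1] st.
by rewrite /powR gt_eqF// ltr_expR ltr_nM2r// ln_lt0// a0.
Qed.

Section ArcsinInverse.
Variables (p q : R).
Hypotheses (p1 : 1 < p) (q1 : 1 < q).

Let p0 : 0 < p. Proof. exact: lt_trans p1. Qed.
Let q0 : 0 < q. Proof. exact: lt_trans q1. Qed.

Let pr b : 0 <= b <= 1 -> primitive b (arcsin_pq p q) (arcsin_density p q).
Proof. by move=> b01; apply: primitive_arcsin => //; exact: ltW. Qed.

Let pr1 : primitive 1 (arcsin_pq p q) (arcsin_density p q).
Proof. by apply: pr; rewrite ler01 lexx. Qed.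

Let gt0 z : 0 < z < 1 -> 0 < arcsin_density p q z.
Proof. by move=> /andP[z0 z1]; rewrite arcsin_density_gt0// ltW. Qed.

Lemma arcsin_lt x y : 0 <= x -> x < y -> y <= 1 ->
  arcsin_pq p q x < arcsin_pq p q y.
Proof. by move=> x0 xy y1; exact: (primitive_increasing pr1). Qed.

Lemma arcsin_le x y : 0 <= x -> x <= y -> y <= 1 ->
  arcsin_pq p q x <= arcsin_pq p q y.
Proof.
move=> x0; rewrite le_eqVlt => /predU1P[->//|xy y1].
by apply: ltW; exact: arcsin_lt.
Qed.

Lemma arcsin0 : arcsin_pq p q 0 = 0.
Proof. by have [] := pr1. Qed.

(** The density is at least 1. In particular pi_pq / 2 is greater than every y
    below 1, so that such a y is a value of arcsin_pq. *)
Lemma arcsin_ge_id x : 0 <= x <= 1 -> x <= arcsin_pq p q x.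
Proof.
move=> /[dup] x01 /andP[x0 x1].
apply: (primitive_leq0 (primitive_id x) (pr x01)) => // z /andP[z0 zx].
have z1 : z < 1 by exact: lt_le_trans x1.
have -> : cst 1 z = 1 `^ (- p^-1) :> R by rewrite powR1.
apply: powR_leN.
- by rewrite invr_ge0 ltW.
- by rewrite arcsin_density_base_gt0// ltW.
- by rewrite gerBl powR_ge0.
Qed.

Lemma arcsin_inj : {in `[0, 1]%classic &, injective (arcsin_pq p q)}.
Proof.
move=> x y; rewrite !inE/= !in_itv/= => /andP[x0 x1] /andP[y0 y1] E.
by case: (ltgtP x y) => // /arcsin_lt H; [move: (H x0 y1)|move: (H y0 x1)];
  rewrite E ltxx.
Qed.

Lemma pi_half : pi_pq p q / 2 = arcsin_pq p q 1.
Proof. by rewrite /pi_pq mulrC mulKf// pnatr_eq0. Qed.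

Lemma arcsin_exists y : 0 < y < 1 -> exists2 x, 0 < x < 1 & arcsin_pq p q x = y.
Proof.
move=> /andP[y0 y1]; apply: (primitive_ivt pr1) => //.
by rewrite y0 (lt_le_trans y1)// arcsin_ge_id// ler01 lexx.
Qed.

Variable x : R.
Hypothesis x01 : 0 < x < 1.

Lemma tam_dom_arcsin : tam_dom p q (arcsin_pq p q x).
Proof.
have /andP[x0 x1] := x01.
rewrite /tam_dom /= in_itv/= pi_half; apply/andP; split.
  by rewrite -arcsin0 arcsin_le// ltW.
by rewrite arcsin_lt// ltW.
Qed.

Lemma sin_dom_arcsin : sin_dom p q (arcsin_pq p q x).
Proof.
have := tam_dom_arcsin; rewrite /tam_dom /sin_dom /= !in_itv/=.
by move=> /andP[-> /ltW].
Qed.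

Let inverse := primitive_inverse pr1 gt0 (@subset_refl _ _) arcsin_inj x01.

Lemma sin_arcsin : sin_pq p q (arcsin_pq p q x) = x.
Proof. by have [] := inverse. Qed.

(** By the inverse function rule: the derivative of the inverse is the inverse
    of the density. The point is interior to the domain because x is below 1. *)
Lemma cos_arcsin : cos_pq p q (arcsin_pq p q x) = (1 - x `^ q) `^ p^-1.
Proof.
have /andP[x0 x1] := x01.
have [_ d] := inverse.
rewrite /cos_pq (derive_in_interior _ d); last first.
  have : \forall z \near arcsin_pq p q x, z \in `]0, arcsin_pq p q 1[.
    apply: near_in_itvoo.
    by rewrite in_itv/= -{1}arcsin0 !arcsin_lt// ltW.
  apply: filterS => z; rewrite /sin_dom /= pi_half !in_itv/=.
  by move=> /andP[/ltW -> /ltW].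
by rewrite /arcsin_density powRN invrK.
Qed.

Lemma tam_arcsin :
  tam_pq p q (arcsin_pq p q x) = x / (1 - x `^ q) `^ q^-1.
Proof.
rewrite /tam_pq sin_arcsin cos_arcsin -powRrM mulrA mulVf ?mul1r//.
by rewrite gt_eqF.
Qed.

End ArcsinInverse.

Section ArcsinhInverse.
Variables (p q : R).
Hypotheses (p1 : 1 < p) (q1 : 1 < q).

Let p0 : 0 < p. Proof. exact: lt_trans p1. Qed.
Let q0 : 0 < q. Proof. exact: lt_trans q1. Qed.

Let pr b : 0 <= b -> primitive b (arcsinh_pq p q) (arcsinh_density p q).
Proof. by move=> b0; exact: primitive_arcsinh. Qed.

Lemma arcsinh_lt x y : 0 <= x -> x < y ->
  arcsinh_pq p q x < arcsinh_pq p q y.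
Proof.
move=> x0 xy.
apply: (primitive_increasing (pr (le_trans x0 (ltW xy)))) => // z _.
exact: arcsinh_density_gt0.
Qed.

Lemma arcsinh_le x y : 0 <= x -> x <= y ->
  arcsinh_pq p q x <= arcsinh_pq p q y.
Proof.
move=> x0; rewrite le_eqVlt => /predU1P[->//|xy].
by apply: ltW; exact: arcsinh_lt.
Qed.

Lemma arcsinh0 : arcsinh_pq p q 0 = 0.
Proof. by have [] := pr (lexx 0). Qed.

Lemma arcsinh_le_id x : 0 <= x -> arcsinh_pq p q x <= x.
Proof.
move=> x0; apply: (primitive_leq0 (pr x0) (primitive_id x)) => // z _.
exact: arcsinh_density_le1.
Qed.

Lemma arcsinh_inj : {in `[0, +oo[%classic &, injective (arcsinh_pq p q)}.
Proof.
move=> x y; rewrite !inE/= !in_itv/= !andbT => x0 y0 E.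
by case: (ltgtP x y) => // /arcsinh_lt H; [move: (H x0)|move: (H y0)];
  rewrite E ltxx.
Qed.

(** The integral over the half-line, finite or not, dominates the integral over
    [0, x + 1], which exceeds the one over [0, x]. *)
Lemma hpi_half_gt x : 0 <= x -> ((arcsinh_pq p q x)%:E < hpi_pq p q / 2%:E)%E.
Proof.
move=> x0; have x1 : 0 <= x + 1 by rewrite addr_ge0.
apply: (@lt_le_trans _ _ (arcsinh_pq p q (x + 1))%:E).
  by rewrite lte_fin arcsinh_lt// ltrDl.
rewrite /hpi_pq muleC muleA.
have -> : (2%:E^-1 * 2%:E = 1 :> \bar R)%E.
  by rewrite inver pnatr_eq0/= -EFinM mulVf// pnatr_eq0.
rewrite mul1e /arcsinh_pq /Rintegral fineK; last first.
  apply: integrable_fin_num => //; apply: (@integrable_bounded_itv _ _ 1).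
    exact: measurable_arcsinh_density.
  by move=> z _; rewrite arcsinh_density_le1// ltW// arcsinh_density_gt0.
apply: ge0_subset_integral => //.
- by apply/measurable_EFinP; exact: measurable_arcsinh_density.
- by move=> z _; rewrite lee_fin ltW// arcsinh_density_gt0.
- by move=> z; rewrite /= !in_itv/= => /andP[->].
Qed.

Variable x : R.
Hypothesis x0 : 0 < x.

Lemma sinh_dom_arcsinh : sinh_dom p q (arcsinh_pq p q x).
Proof.
split; last by apply: hpi_half_gt; exact: ltW.
by rewrite -arcsinh0 arcsinh_le// ltW.
Qed.

Let xin : 0 < x < x + 1. Proof. by rewrite x0 ltrDl ltr01. Qed.

Let inverse :
  sinh_pq p q (arcsinh_pq p q x) = x /\
  is_derive (arcsinh_pq p q x) 1 (sinh_pq p q) (arcsinh_density p q x)^-1.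
Proof.
apply: (primitive_inverse (pr (b := x + 1) _) _ _ arcsinh_inj xin).
- by rewrite addr_ge0// ltW.
- by move=> z _; exact: arcsinh_density_gt0.
- by move=> z; rewrite /= !in_itv/= => /andP[->].
Qed.

Lemma sinh_arcsinh : sinh_pq p q (arcsinh_pq p q x) = x.
Proof. by have [] := inverse. Qed.

Lemma cosh_arcsinh : cosh_pq p q (arcsinh_pq p q x) = (1 + x `^ q) `^ p^-1.
Proof.
have [_ d] := inverse.
rewrite /cosh_pq (derive_in_interior _ d); last first.
  have : \forall z \near arcsinh_pq p q x,
      z \in `]0, arcsinh_pq p q (x + 1)[.
    apply: near_in_itvoo.
    by rewrite in_itv/= -{1}arcsinh0 !arcsinh_lt// ?ltrDl// ltW.
  apply: filterS => z; rewrite in_itv/= => /andP[z0 zx]; split; first exact: ltW.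
  apply: (@lt_trans _ _ (arcsinh_pq p q (x + 1))%:E); first by rewrite lte_fin.
  by apply: hpi_half_gt; rewrite addr_ge0// ltW.
by rewrite /arcsinh_density powRN invrK.
Qed.

Lemma tamh_arcsinh :
  tamh_pq p q (arcsinh_pq p q x) = x / (1 + x `^ q) `^ q^-1.
Proof.
rewrite /tamh_pq sinh_arcsinh cosh_arcsinh -powRrM mulrA mulVf ?mul1r//.
by rewrite gt_eqF.
Qed.

End ArcsinhInverse.

End InverseFunctions.

(** * The variable of tamh *)

Section Tamh.
Variable R : realType.
Implicit Types (g F : R -> R) (a b p q s t x y z w : R).

Lemma primitive_at_right b F g : 0 < b -> F 0 = 0 ->
  F w @[w --> 0^'+] --> 0 ->
  (forall w, 0 < w <= b -> is_derive w 1 F (g w)) -> primitive b F g.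
Proof.
move=> b0 F0 cF dF; split=> //; last first.
  by move=> x /andP[x0 /ltW xb]; apply: dF; rewrite x0.
have cont w : 0 < w <= b -> {for w, continuous F}.
  move=> /dF [d _].
  by apply: differentiable_continuous; apply/derivable1_diffP.
apply/(continuous_within_itvP _ b0); split.
- by move=> w; rewrite in_itv/= => /andP[w0 /ltW wb]; apply: cont; rewrite w0.
- by rewrite F0.
- apply: cvg_within_filter; apply: cont; by rewrite b0 lexx.
Qed.

(** The inverse of x |-> x / (1 + x `^ q) `^ q^-1, which sends the value of sinh
    to the value of tamh. *)
Definition of_tamh q w : R := w * (1 - w `^ q) `^ (- q^-1).
(** The density of the inverse function of tamh_pq. *)
Definition tamh_density p q w : R := (1 - w `^ q) `^ (- (1 + q^-1 - p^-1)).

Section Fixed.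
Variables (p q : R).
Hypotheses (p1 : 1 < p) (q1 : 1 < q).

Let p0 : 0 < p. Proof. exact: lt_trans p1. Qed.
Let q0 : 0 < q. Proof. exact: lt_trans q1. Qed.

Let base w : 0 < w < 1 -> 0 < 1 - w `^ q.
Proof. by move=> /andP[w0 w1]; rewrite arcsin_density_base_gt0// ltW. Qed.

Lemma of_tamh_gt0 w : 0 < w < 1 -> 0 < of_tamh q w.
Proof.
by move=> /[dup] /andP[w0 _] w01; rewrite mulr_gt0// powR_gt0// base.
Qed.

(** In the product rule the common factor is (1 - w `^ q) `^ (- q^-1 - 1), and
    the remaining factor is (1 - w `^ q) + w `^ q. *)
Lemma is_derive_of_tamh w : 0 < w < 1 ->
  is_derive w 1 (of_tamh q) ((1 - w `^ q) `^ (- q^-1 - 1)).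
Proof.
move=> /[dup] w01 /andP[w0 w1].
have B0 := base w01.
have d1 : is_derive w 1 (fun t : R => 1 - t `^ q) (- (q * w `^ (q - 1))).
  have := is_deriveB (is_derive_cst (1 : R) w 1) (is_derive1_powR q w0).
  by rewrite sub0r.
have d2 := is_derive1_powR (- q^-1) B0.
have d3 := is_derive1_comp (f := fun u : R => u `^ (- q^-1))
  (g := fun t : R => 1 - t `^ q) d2 d1.
have d4 := is_deriveM (is_derive_id w (1 : R)) d3.
apply: is_derive_eq d4 _.
rewrite /GRing.scale/= mulr1.
have -> : (1 - w `^ q) `^ (- q^-1) =
    (1 - w `^ q) `^ (- q^-1 - 1) * (1 - w `^ q).
  by rewrite -{3}(powRr1 (ltW B0)) -powRD ?subrK// (gt_eqF B0) /= implybT.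
rewrite -(mulr_powRB1 (ltW w0) q0).
have qn : q != 0 by rewrite gt_eqF.
set A := (_ `^ (- q^-1 - 1)); set W := w `^ (q - 1).
by field.
Qed.

(** Continuity at 0 has to be shown apart, because the derivative formula for
    real powers is available only at positive points. *)
Lemma of_tamh_cvg0 : of_tamh q w @[w --> 0^'+] --> 0.
Proof.
have c1 : (1 - w `^ q : R) @[w --> 0^'+] --> (1 - 0 : R).
  by apply: cvgB; [exact: cvg_cst|exact: powR_cvg0].
have c2 : {for 1 - 0, continuous (fun u : R => u `^ (- q^-1))}.
  by apply: continuous_powR; rewrite subr0.
have c3 : ((1 - w `^ q) `^ (- q^-1) : R) @[w --> 0^'+] --> ((1 - 0) `^ (- q^-1) : R).
  exact: (cvg_comp _ _ c1 c2).
have c0 : (w : R) @[w --> 0^'+] --> (0 : R).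
  by apply: cvg_at_right_filter; exact: cvg_id.
have := cvgM c0 c3; rewrite mul0r; exact.
Qed.

Lemma one_plus_of_tamh_powR w : 0 < w < 1 ->
  1 + of_tamh q w `^ q = (1 - w `^ q)^-1.
Proof.
move=> /[dup] w01 /andP[w0 w1]; have B0 := base w01.
rewrite /of_tamh powRM ?powR_ge0 ?(ltW w0)// -powRrM mulNr mulVf ?gt_eqF//.
rewrite powR_inv1 ?(ltW B0)//.
have : 1 - w `^ q != 0 by rewrite gt_eqF.
by set W := w `^ q => Bn; field.
Qed.

(** The change of variable z = of_tamh q w in the integral defining arcsinh:
    1 + z `^ q is the inverse of 1 - w `^ q, so the two powers of 1 - w `^ q
    combine into the exponent - (1 + q^-1 - p^-1). *)
Lemma primitive_arcsinh_of_tamh b : 0 < b < 1 ->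
  primitive b (arcsinh_pq p q \o of_tamh q) (tamh_density p q).
Proof.
move=> /andP[b0 b1]; apply: primitive_at_right => //=.
- by rewrite /of_tamh mul0r arcsinh0.
- apply: (squeeze_cvgr _ (cvg_cst (0 : R)) of_tamh_cvg0).
  near=> w; have w01 : 0 < w < 1 by apply/andP; split; near: w;
    [exact: nbhs_right_gt|exact: nbhs_right_lt].
  have w0 := ltW (of_tamh_gt0 w01).
  by rewrite arcsinh_le_id// andbT -[leLHS](arcsinh0 q p1) arcsinh_le.
- move=> w /andP[w0 wb].
  have w01 : 0 < w < 1 by rewrite w0 (le_lt_trans wb).
  have x0 := of_tamh_gt0 w01; set x := of_tamh q w in x0.
  have [_ _ dA] := primitive_arcsinh (b := x + 1) q p0 (addr_ge0 (ltW x0) ler01).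
  have d1 := dA x; rewrite x0 ltrDl ltr01 in d1.
  have d := is_derive1_comp (d1 isT) (is_derive_of_tamh w01).
  apply: is_derive_eq d _.
  rewrite /arcsinh_density one_plus_of_tamh_powR// -powR_inv1; last by rewrite ltW// base.
  rewrite -powRrM mulN1r opprK -powRD; last by rewrite (gt_eqF (base w01)) /= implybT.
  by rewrite /tamh_density; congr (_ `^ _); ring.
Unshelve. all: by end_near. Qed.

Lemma tamh_exponent_gt0 : 0 < 1 + q^-1 - p^-1.
Proof.
have : p^-1 < 1 by rewrite invf_lt1.
have : 0 < q^-1 by rewrite invr_gt0.
lra.
Qed.

Lemma tamh_density_ge1 w : 0 < w < 1 -> 1 <= tamh_density p q w.
Proof.
move=> w01; have -> : 1 = 1 `^ (- (1 + q^-1 - p^-1)) :> R by rewrite powR1.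
apply: powR_leN; [exact/ltW/tamh_exponent_gt0|exact: base|].
by rewrite gerBl powR_ge0.
Qed.

(** In the variable of tamh the density is at least 1, so arcsinh_pq takes at
    of_tamh q w a value of at least w, for every w below 1. This is the
    inequality hpi_pq / 2 >= 1 in the form in which it is used. *)
Lemma arcsinh_exists y : 0 < y < 1 ->
  exists2 x, 0 < x & arcsinh_pq p q x = y.
Proof.
move=> /andP[y0 y1]; pose w : R := (y + 1) / 2.
have w01 : 0 < w < 1 by apply/andP; split; rewrite /w; lra.
have yw : y < w by rewrite /w; lra.
have [w0 w1] := andP w01.
have x0 := of_tamh_gt0 w01.
have [|x /andP[? _] ?] := primitive_ivt (y := y)
  (primitive_arcsinh q p0 (ltW x0)) _ x0; last by exists x.
rewrite y0/=; apply: (lt_le_trans yw).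
apply: (primitive_leq0 (primitive_id w) (primitive_arcsinh_of_tamh w01) (ltW w0)).
by move=> z /andP[z0 zw]; apply: tamh_density_ge1; rewrite z0 (lt_trans zw).
Qed.

Lemma tamh_bound x : 0 < x ->
  0 < x / (1 + x `^ q) `^ q^-1 < 1.
Proof.
move=> x0; have xq := powR_gt0 q x0.
have B0 : 0 < 1 + x `^ q by rewrite ltr_pwDl// ltW.
have D0 : 0 < (1 + x `^ q) `^ q^-1 by rewrite powR_gt0.
rewrite divr_gt0//= ltr_pdivrMr// mul1r.
have {1}-> : x = (x `^ q) `^ q^-1.
  by rewrite -powRrM mulfV ?gt_eqF// powRr1// ltW.
by apply: gt0_ltr_powR; rewrite ?invr_gt0// ?nnegrE ?ltW// ltrDr ltr01.
Qed.

Lemma of_tamhK x : 0 < x -> of_tamh q (x / (1 + x `^ q) `^ q^-1) = x.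
Proof.
move=> x0; have xq := powR_gt0 q x0.
have B0 : 0 < 1 + x `^ q by rewrite ltr_pwDl// ltW.
have D0 : 0 < (1 + x `^ q) `^ q^-1 by rewrite powR_gt0.
rewrite /of_tamh -powRN powRM ?powR_ge0 ?(ltW x0)//.
rewrite -(powRrM _ (- q^-1)) mulNr mulVf ?gt_eqF// powR_inv1 ?(ltW B0)//.
have -> : 1 - x `^ q / (1 + x `^ q) = (1 + x `^ q)^-1.
  have : 1 + x `^ q != 0 by rewrite gt_eqF.
  by set W := x `^ q => Bn; field.
rewrite -[(1 + x `^ q)^-1]powR_inv1 ?(ltW B0)// -powRrM mulN1r opprK -mulrA -powRD.
  by rewrite addNr powRr0 mulr1.
by rewrite (gt_eqF B0) /= implybT.
Qed.

End Fixed.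

End Tamh.

(** * Monotonicity in p and q *)

#[local] Opaque arcsin_pq arcsinh_pq sin_pq cos_pq tam_pq sinh_pq cosh_pq.

Section Monotonicity.
Variable R : realType.
Implicit Types (a b p q s t x y z w : R).

Lemma arcsin_anti_lt p1 q1 p2 q2 x1 x2 :
  1 < p1 -> 1 < q1 -> 1 < p2 -> 1 < q2 ->
  (forall z, 0 < z < 1 -> arcsin_density p2 q2 z < arcsin_density p1 q1 z) ->
  0 < x1 < 1 -> 0 < x2 < 1 ->
  arcsin_pq p1 q1 x1 = arcsin_pq p2 q2 x2 -> x1 < x2.
Proof.
move=> hp1 hq1 hp2 hq2 den /andP[x10 x11] /andP[x20 x21].
have x1in : 0 <= x1 <= 1 by rewrite !ltW.
apply: (primitive_inverse_lt (primitive_arcsin hp1 (ltW hq1) x1in)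
  (primitive_arcsin hp2 (ltW hq2) x1in) _ x10 (ltW x20)).
move=> z /andP[z0 zx]; rewrite arcsin_density_ge0/=; apply: den.
by rewrite z0 (lt_trans zx).
Qed.

Lemma arcsinh_anti_lt p1 p2 q x1 x2 :
  1 < p1 -> 1 < p2 -> p1 < p2 -> 1 < q -> 0 < x1 -> 0 < x2 ->
  arcsinh_pq p1 q x1 = arcsinh_pq p2 q x2 -> x2 < x1.
Proof.
move=> hp1 hp2 p12 hq x10 x20 /esym.
have [p10 p20] : 0 < p1 /\ 0 < p2 by split; exact: lt_trans ltr01 _.
apply: (primitive_inverse_lt (primitive_arcsinh q p20 (ltW x20))
  (primitive_arcsinh q p10 (ltW x20)) _ x20 (ltW x10)) => z /andP[z0 zx].
rewrite (ltW (arcsinh_density_gt0 _ _ _))/=.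
apply: gt1_lt_powR; first by rewrite ltrDl powR_gt0.
by rewrite ltrN2 ltf_pV2 ?posrE.
Qed.

(** Makes tam and tamh a single power of x `^ q / (1 - x `^ q), respectively of
    x `^ q / (1 + x `^ q). *)
Lemma divr_powR_invE a b q : 0 < q -> 0 < a -> 0 < b ->
  a / b `^ q^-1 = (a `^ q / b) `^ q^-1.
Proof.
move=> q0 a0 b0; rewrite powRM ?powR_ge0 ?invr_ge0 ?(ltW b0)//.
rewrite -powRrM mulfV ?gt_eqF// powRr1 ?(ltW a0)//.
rewrite -[b^-1]powR_inv1 ?(ltW b0)// powRAC powR_inv1//; exact: powR_ge0.
Qed.

(** Both solutions are kept, rather than the inequality between the values of
    sin only, because tam is compared through them as well. *)
Lemma arcsin_p_solutions q y p1 p2 : 0 < y < 1 -> 1 < q -> 1 < p1 -> p1 < p2 ->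
  exists x1 x2, [/\ 0 < x1 < 1, 0 < x2 < 1, arcsin_pq p1 q x1 = y,
    arcsin_pq p2 q x2 = y & x1 < x2].
Proof.
move=> y01 hq hp1 p12; have hp2 := lt_trans hp1 p12.
have [x1 x1in E1] := arcsin_exists hp1 hq y01.
have [x2 x2in E2] := arcsin_exists hp2 hq y01.
exists x1, x2; split => //.
apply: (arcsin_anti_lt hp1 hq hp2 hq _ x1in x2in); last by rewrite E1 E2.
move=> z /andP[z0 z1]; have q0 : 0 < q by exact: lt_trans hq.
apply: lt1_lt_powR; last by rewrite ltrN2 ltf_pV2 ?posrE ?(lt_trans ltr01).
rewrite arcsin_density_base_gt0 ?(ltW z0)//= gtrBl ?powR_gt0//.
Qed.

Lemma sin_q_lt p y q1 q2 : 0 < y < 1 -> 1 < p -> 1 < q1 -> q1 < q2 ->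
  sin_pq p q1 y < sin_pq p q2 y.
Proof.
move=> y01 hp hq1 q12; have hq2 := lt_trans hq1 q12.
have p0 : 0 < p by exact: lt_trans hp.
have [x1 x1in E1] := arcsin_exists hp hq1 y01.
have [x2 x2in E2] := arcsin_exists hp hq2 y01.
rewrite -{1}E1 -E2 !sin_arcsin//.
apply: (arcsin_anti_lt hp hq1 hp hq2 _ x1in x2in); last by rewrite E1 E2.
move=> z /[dup] z01 /andP[z0 z1]; apply: powR_ltN; first by rewrite invr_gt0.
  by rewrite arcsin_density_base_gt0 ?(ltW z0)// (lt_trans ltr01).
by rewrite ltrD2l ltrN2 lt1_lt_powR.
Qed.

Lemma tam_p_lt q y p1 p2 : 0 < y < 1 -> 1 < q -> 1 < p1 -> p1 < p2 ->
  tam_pq p1 q y < tam_pq p2 q y.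
Proof.
move=> y01 hq hp1 p12; have hp2 := lt_trans hp1 p12.
have q0 : 0 < q by exact: lt_trans hq.
have [x1 [x2 [x1in x2in E1 E2 x12]]] := arcsin_p_solutions y01 hq hp1 p12.
rewrite -{1}E1 -E2 !tam_arcsin//.
have [[x10 x11] [x20 x21]] := (andP x1in, andP x2in).
have b1 : 0 < 1 - x1 `^ q by rewrite arcsin_density_base_gt0// ltW.
have b2 : 0 < 1 - x2 `^ q by rewrite arcsin_density_base_gt0// ltW.
apply: (@lt_trans _ _ (x2 / (1 - x1 `^ q) `^ q^-1)).
  by rewrite ltr_pM2r// invr_gt0 powR_gt0.
rewrite (ltr_pM2l x20) ltf_pV2 ?posrE ?powR_gt0//.
apply: gt0_ltr_powR; [by rewrite invr_gt0|by rewrite nnegrE ltW|by rewrite nnegrE ltW|].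
by rewrite ltrD2l ltrN2; apply: gt0_ltr_powR => //; rewrite nnegrE ltW.
Qed.

Lemma arcsinh_p_solutions q y p1 p2 : 0 < y < 1 -> 1 < q -> 1 < p1 -> p1 < p2 ->
  exists x1 x2, [/\ 0 < x1, 0 < x2, arcsinh_pq p1 q x1 = y,
    arcsinh_pq p2 q x2 = y & x2 < x1].
Proof.
move=> y01 hq hp1 p12; have hp2 := lt_trans hp1 p12.
have [x1 x1in E1] := arcsinh_exists hp1 hq y01.
have [x2 x2in E2] := arcsinh_exists hp2 hq y01.
exists x1, x2; split => //.
by apply: (arcsinh_anti_lt hp1 hp2 p12 hq x1in x2in); rewrite E1 E2.
Qed.

Lemma cosh_p_gt q y p1 p2 : 0 < y < 1 -> 1 < q -> 1 < p1 -> p1 < p2 ->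
  cosh_pq p2 q y < cosh_pq p1 q y.
Proof.
move=> y01 hq hp1 p12; have hp2 := lt_trans hp1 p12.
have q0 : 0 < q by exact: lt_trans hq.
have p10 : 0 < p1 by exact: lt_trans hp1.
have p20 : 0 < p2 by exact: lt_trans hp2.
have [x1 [x2 [x1in x2in E1 E2 x12]]] := arcsinh_p_solutions y01 hq hp1 p12.
rewrite -{1}E2 -E1 !cosh_arcsinh//.
apply: (@lt_trans _ _ ((1 + x2 `^ q) `^ p1^-1)).
  apply: gt1_lt_powR; first by rewrite ltrDl powR_gt0.
  by rewrite ltf_pV2 ?posrE.
apply: gt0_ltr_powR; rewrite ?invr_gt0// ?nnegrE ?addr_ge0 ?powR_ge0//.
by rewrite ltrD2l; apply: gt0_ltr_powR => //; rewrite nnegrE ltW.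
Qed.

Lemma tamh_p_gt q y p1 p2 : 0 < y < 1 -> 1 < q -> 1 < p1 -> p1 < p2 ->
  tamh_pq p2 q y < tamh_pq p1 q y.
Proof.
move=> y01 hq hp1 p12; have hp2 := lt_trans hp1 p12.
have q0 : 0 < q by exact: lt_trans hq.
have [x1 [x2 [x1in x2in E1 E2 x12]]] := arcsinh_p_solutions y01 hq hp1 p12.
rewrite -{1}E2 -E1 !tamh_arcsinh//.
have b1 : 0 < 1 + x1 `^ q by rewrite addr_gt0 ?powR_gt0.
have b2 : 0 < 1 + x2 `^ q by rewrite addr_gt0 ?powR_gt0.
have u : x2 `^ q < x1 `^ q.
  by apply: gt0_ltr_powR => //; rewrite nnegrE ltW.
rewrite !divr_powR_invE//; apply: gt0_ltr_powR; rewrite ?invr_gt0//.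
- by rewrite nnegrE divr_ge0 ?powR_ge0// ltW.
- by rewrite nnegrE divr_ge0 ?powR_ge0// ltW.
rewrite ltr_pdivrMr// mulrAC ltr_pdivlMr//.
by move: u; set U := x2 `^ q; set V := x1 `^ q; lra.
Qed.

Lemma tamh_density_q_lt p q1 q2 z : 1 < p -> 1 < q1 -> q1 < q2 -> 0 < z < 1 ->
  tamh_density p q2 z < tamh_density p q1 z.
Proof.
move=> hp hq1 q12 /[dup] z01 /andP[z0 z1]; have hq2 := lt_trans hq1 q12.
have q10 : 0 < q1 by exact: lt_trans hq1.
have q20 : 0 < q2 by exact: lt_trans hq2.
have b1 : 0 < 1 - z `^ q1 by rewrite arcsin_density_base_gt0// ltW.
have b2 : 0 < 1 - z `^ q2 by rewrite arcsin_density_base_gt0// ltW.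
apply: (@lt_trans _ _ ((1 - z `^ q2) `^ (- (1 + q1^-1 - p^-1)))).
  apply: lt1_lt_powR; first by rewrite b2 gtrBl powR_gt0.
  by rewrite ltrN2 ltrD2r ltrD2l ltf_pV2 ?posrE.
apply: powR_ltN => //; first exact: tamh_exponent_gt0.
by rewrite ltrD2l ltrN2 lt1_lt_powR.
Qed.

(** The density of arcsinh increases in q at points below 1 and decreases in q
    at points above 1, which is
    why sinh itself is not monotonic in q. In the variable w of tamh the whole
    range is below 1, and the density decreases in q: its base 1 - w `^ q grows, and
    1 + q^-1 - p^-1 stays positive and shrinks. *)
Lemma tamh_q_lt p y q1 q2 : 0 < y < 1 -> 1 < p -> 1 < q1 -> q1 < q2 ->
  tamh_pq p q1 y < tamh_pq p q2 y.
Proof.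
move=> y01 hp hq1 q12; have hq2 := lt_trans hq1 q12.
have [x1 x10 E1] := arcsinh_exists hp hq1 y01.
have [x2 x20 E2] := arcsinh_exists hp hq2 y01.
rewrite -{1}E1 -E2 !tamh_arcsinh//.
have := of_tamhK hq1 x10; have := tamh_bound hq1 x10; set w1 := x1 / _.
move=> /[dup] w1in /andP[w10 w11] K1.
have := of_tamhK hq2 x20; have := tamh_bound hq2 x20; set w2 := x2 / _.
move=> /[dup] w2in /andP[w20 w21] K2.
have P1 := primitive_arcsinh_of_tamh hp hq1 w1in.
have P2 := primitive_arcsinh_of_tamh hp hq2 w1in.
apply: (primitive_inverse_lt P1 P2 _ w10 (ltW w20)).
  move=> z /andP[z0 zw]; rewrite powR_ge0/=; apply: tamh_density_q_lt => //.
  by rewrite z0 (lt_trans zw).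
by rewrite /= K1 K2 E1 E2.
Qed.

End Monotonicity.

(** * Explicit estimates at integer exponents *)

Section Estimates.
Variable R : realType.
Implicit Types (f g F G : R -> R) (a b c p q s t u v x y z w : R) (n : nat).

Lemma primitiveD b F f G g : primitive b F f -> primitive b G g ->
  primitive b (F \+ G) (f \+ g).
Proof.
move=> [F0 cF dF] [G0 cG dG]; split.
- by rewrite /= F0 G0 addr0.
- by move=> x; apply: cvgD; [exact: cF|exact: cG].
- by move=> x xb; apply: is_deriveD; [exact: dF|exact: dG].
Qed.

Lemma is_derive_expr n x :
  is_derive x 1 (fun t : R => t ^+ n.+1) (n.+1%:R * x ^+ n).
Proof.
have := is_deriveX n (is_derive_id x (1 : R)).
have := is_deriveX n.+1 (is_derive_id x (1 : R)).
rewrite /= /GRing.scale/= mulr1 => d _.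
have E : (fun t : R => t ^+ n.+1) = (@id R) ^+ n.+1.
  by apply/funext => t; rewrite fctE.
by rewrite E.
Qed.

Lemma primitive_monomial b c n :
  primitive b (fun x => c * x ^+ n.+1 / n.+1%:R) (fun t => c * t ^+ n).
Proof.
apply: primitive_of_derive; first by rewrite expr0n/= mulr0 mul0r.
move=> x _.
have d := is_deriveM (is_derive_cst (c / n.+1%:R : R) x 1) (is_derive_expr n x).
have E : (fun x => c * x ^+ n.+1 / n.+1%:R) =
    cst (c / n.+1%:R) * (fun t : R => t ^+ n.+1).
  by apply/funext => t; rewrite fctE /= mulrAC.
rewrite E; apply: is_derive_eq d _.
have nn : n.+1%:R != 0 :> R by rewrite pnatr_eq0.
by rewrite scaler0 addr0 /GRing.scale/= mulrA divfK.
Qed.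

(** The convex function (1 + v) `^ (- s) lies above its tangent at v = 0. *)
Lemma powRN_ge_tangent s v : 0 <= s -> 0 <= v -> 1 - s * v <= (1 + v) `^ (- s).
Proof.
move=> s0 v0; have v1 : 0 < 1 + v by rewrite ltr_pwDl.
rewrite /powR gt_eqF//; apply: le_trans (expR_ge1Dx _).
rewrite lerD2l mulNr lerN2; apply: ler_wpM2l => //.
by apply: le_ln1Dx; lra.
Qed.

Lemma powRN_1B_ge_tangent s u : 0 <= s -> 0 <= u < 1 ->
  1 + s * u <= (1 - u) `^ (- s).
Proof.
move=> s0 /andP[u0 u1]; have v1 : 0 < 1 - u by rewrite subr_gt0.
rewrite /powR gt_eqF//; apply: le_trans (expR_ge1Dx _).
rewrite lerD2l mulNr -mulrN; apply: ler_wpM2l => //.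
rewrite lerNr; apply: le_ln1Dx; lra.
Qed.

Lemma arcsin_ge_poly p n x : 1 < p -> (0 < n)%N -> 0 <= x <= 1 ->
  x + p^-1 * x ^+ n.+1 / n.+1%:R <= arcsin_pq p n%:R x.
Proof.
move=> p1 n0 /[dup] x01 /andP[x0 x1].
have q1 : 1 <= n%:R :> R by rewrite ler1n.
have q0 : 0 < n%:R :> R by rewrite ltr0n.
have P := primitiveD (primitive_id x) (primitive_monomial x p^-1 n).
apply: (primitive_leq0 P (primitive_arcsin p1 q1 x01) x0) => z /andP[z0 zx] /=.
have z1 := lt_le_trans zx x1.
rewrite -powR_mulrn ?(ltW z0)//; apply: powRN_1B_ge_tangent.
  by rewrite invr_ge0 ltW// (lt_trans ltr01).
by rewrite powR_ge0 powR_lt1// (ltW z0).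
Qed.

Lemma is_derive_1Bexpr_powR a n x : x ^+ n.+1 < 1 ->
  is_derive x 1 (fun t : R => (1 - t ^+ n.+1) `^ a)
    (- (a * (1 - x ^+ n.+1) `^ (a - 1) * (n.+1%:R * x ^+ n))).
Proof.
move=> xn1; have B0 : 0 < 1 - x ^+ n.+1 by rewrite subr_gt0.
have d1 : is_derive x 1 (fun t : R => 1 - t ^+ n.+1) (- (n.+1%:R * x ^+ n)).
  have := is_deriveB (is_derive_cst (1 : R) x 1) (is_derive_expr n x).
  by rewrite sub0r.
have d := is_derive1_comp (f := fun u : R => u `^ a)
  (g := fun t : R => 1 - t ^+ n.+1) (is_derive1_powR a B0) d1.
by apply: is_derive_eq d _; rewrite mulrN.
Qed.

(** With u = t ^+ n.+1, the excess (1 - u) `^ (- p^-1) - 1 of the density over 1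
    is at most t ^+ n * (1 - u) `^ (- p^-1), whose primitive is elementary.
    Hence arcsin_pq tends to the identity as the exponent q grows. *)
Lemma arcsin_le_tail p n x : 1 < p -> 0 <= x < 1 ->
  arcsin_pq p n.+1%:R x <= x + (1 - p^-1)^-1 / n.+1%:R.
Proof.
move=> p1 /[dup] x01 /andP[x0 x1].
have p0 : 0 < p by rewrite (lt_trans ltr01).
have a0 : 0 < 1 - p^-1 by rewrite subr_gt0 invf_lt1.
set a := 1 - p^-1 in a0 *.
have q0 : 0 < n.+1%:R :> R by rewrite ltr0n.
pose T : R -> R := fun t => a^-1 / n.+1%:R * (1 - (1 - t ^+ n.+1) `^ a).
have PT : primitive x T (fun t => (1 - t ^+ n.+1) `^ (- p^-1) * t ^+ n).
  apply: primitive_of_derive.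
    by rewrite /T expr0n/= subr0 powR1 subrr mulr0.
  move=> t /andP[t0 tx]; have t1 := le_lt_trans tx x1.
  have tn : t ^+ n.+1 < 1 by rewrite exprn_ilt1.
  have d := is_deriveM (is_derive_cst (a^-1 / n.+1%:R : R) t 1)
    (is_deriveB (is_derive_cst (1 : R) t 1) (is_derive_1Bexpr_powR a tn)).
  apply: is_derive_eq d _.
  rewrite scaler0 addr0 sub0r opprK /GRing.scale/=.
  have -> : a - 1 = - p^-1 by rewrite /a addrAC subrr add0r.
  have an : a != 0 by rewrite gt_eqF.
  have qn : n.+1%:R != 0 :> R by rewrite gt_eqF.
  move: qn; set N := n.+1%:R; set A := _ `^ _; set X := t ^+ n => qn.
  by field; rewrite an andbT addrC natr1.
have P := primitiveD (primitive_id x) PT.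
apply: (@le_trans _ _ (x + T x)).
  apply: (primitive_leq0 (primitive_arcsin_lt1 p0 q0 x01) P x0).
  move=> z /andP[z0 zx] /=; have z1 := lt_trans zx x1.
  rewrite /arcsin_density powR_mulrn ?(ltW z0)//.
  have zn : z ^+ n.+1 < 1 by rewrite exprn_ilt1// ltW.
  have B0 : 0 < 1 - z ^+ n.+1 by rewrite subr_gt0.
  have -> : (1 : R) + (1 - z ^+ n.+1) `^ (- p^-1) * z ^+ n
      = (1 - z ^+ n.+1) `^ (- p^-1) * ((1 - z ^+ n.+1) `^ p^-1 + z ^+ n).
    by rewrite mulrDr -powRD ?addNr ?powRr0// (gt_eqF B0) implybT.
  apply: ler_peMr; first exact: powR_ge0.
  have h1 : 1 - z ^+ n.+1 <= (1 - z ^+ n.+1) `^ p^-1.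
    apply: ger1_powR; last by rewrite invf_le1// ltW.
    by rewrite B0 gerBl exprn_ge0// ltW.
  have h2 : z ^+ n.+1 <= z ^+ n.
    by rewrite exprS ler_piMl ?exprn_ge0// ltW.
  by move: h1 h2; set A := _ `^ _; set B := z ^+ n.+1; set C := z ^+ n; lra.
rewrite lerD2l /T ler_piMr//.
  by rewrite divr_ge0// invr_ge0 ltW.
by rewrite gerBl powR_ge0.
Qed.

Lemma arcsinh_ge_poly p n x : 1 < p -> 0 <= x ->
  x - p^-1 * x ^+ n.+1 / n.+1%:R <= arcsinh_pq p n%:R x.
Proof.
move=> p1 x0; have p0 : 0 < p by rewrite (lt_trans ltr01).
have P := primitiveD (primitive_id x) (primitive_monomial x (- p^-1) n).
have := primitive_leq0 P (primitive_arcsinh n%:R p0 x0) x0.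
rewrite /= !mulNr; apply => z /andP[z0 zx].
rewrite mulNr /arcsinh_density powR_mulrn ?(ltW z0)//; apply: powRN_ge_tangent.
  by rewrite invr_ge0 ltW.
by rewrite exprn_ge0// ltW.
Qed.

Lemma powRN_half v : 0 <= v -> v `^ (- 2^-1) = (Num.sqrt v)^-1.
Proof. by move=> v0; rewrite powRN powR12_sqrt. Qed.

(** Multiplying the square of the right-hand side by 1 + v leaves 1 plus v ^+ 3
    times a positive quadratic polynomial; completing the square shows it. *)
Lemma inv_sqrt_le_parabola v : 0 <= v ->
  (1 + v) `^ (- 2^-1) <= 1 + - 2^-1 * v + 3 / 8 * v ^+ 2.
Proof.
move=> v0; have B0 : 0 < 1 + v by lra.
rewrite powRN_half ?(ltW B0)//.
have Q0 : 0 < 1 + - 2^-1 * v + 3 / 8 * v ^+ 2 by nra.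
set Q := 1 + _ + _ in Q0 *.
rewrite -[leLHS]div1r ler_pdivrMr ?sqrtr_gt0//.
rewrite -[leLHS]sqrtr1 -{1}(ger0_norm (ltW Q0)) -sqrtr_sqr -sqrtrM ?sqr_ge0//.
apply: ler_wsqrtr.
have -> : Q ^+ 2 * (1 + v) =
    1 + v ^+ 3 * ((v * (3 / 8) - 5 / 16) ^+ 2 + 135 / 256).
  by rewrite /Q; field.
rewrite lerDl; apply: mulr_ge0; first exact: exprn_ge0.
by apply: addr_ge0; [exact: sqr_ge0|clear; lra].
Qed.

Lemma arcsinh_le_poly n x : 0 <= x ->
  arcsinh_pq 2 n%:R x <=
    x - 2^-1 * x ^+ n.+1 / n.+1%:R + 3 / 8 * x ^+ (n * 2).+1 / (n * 2).+1%:R.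
Proof.
move=> x0; have p0 : 0 < 2 :> R by [].
have P := primitiveD (primitiveD (primitive_id x)
  (primitive_monomial x (- 2^-1) n)) (primitive_monomial x (3 / 8) (n * 2)).
have := primitive_leq0 (primitive_arcsinh n%:R p0 x0) P x0.
rewrite /= !mulNr; apply => z /andP[z0 zx].
rewrite exprM /arcsinh_density powR_mulrn ?(ltW z0)//.
by apply: inv_sqrt_le_parabola; rewrite exprn_ge0// ltW.
Qed.

Lemma primitive_ge_linear b F g c x y : primitive b F g ->
  0 <= x -> x <= y -> y <= b -> (forall z, x < z < y -> c <= g z) ->
  c * (y - x) <= F y - F x.
Proof.
move=> pF x0 xy yb gc.
have := primitive_leq (primitive_monomial b c 0) pF x0 xy yb.
rewrite !expr1 !divr1 -mulrBr; apply => z zxy; rewrite expr0 mulr1; exact: gc.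
Qed.

Lemma primitive_le_linear b F g c x y : primitive b F g ->
  0 <= x -> x <= y -> y <= b -> (forall z, x < z < y -> g z <= c) ->
  F y - F x <= c * (y - x).
Proof.
move=> pF x0 xy yb gc.
have := primitive_leq pF (primitive_monomial b c 0) x0 xy yb.
rewrite !expr1 !divr1 -mulrBr; apply => z zxy; rewrite expr0 mulr1; exact: gc.
Qed.

Lemma arcsinh_density_anti p q s t : 0 < p -> 0 <= q -> 0 <= s -> s <= t ->
  arcsinh_density p q t <= arcsinh_density p q s.
Proof.
move=> p0 q0 s0 st; apply: powR_leN.
- by rewrite invr_ge0 ltW.
- by rewrite ltr_pwDl ?powR_ge0.
- by rewrite lerD2l; apply: ge0_ler_powR; rewrite ?nnegrE// (le_trans s0).
Qed.

Lemma arcsinh_increment_ge p q x y : 0 < p -> 0 <= q -> 0 <= x -> x <= y ->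
  arcsinh_density p q y * (y - x) <= arcsinh_pq p q y - arcsinh_pq p q x.
Proof.
move=> p0 q0 x0 xy.
apply: (primitive_ge_linear (primitive_arcsinh q p0 (le_trans x0 xy))
  x0 xy (lexx y)).
move=> z /andP[xz zy]; apply: arcsinh_density_anti => //; last exact: ltW.
by rewrite (le_trans x0)// ltW.
Qed.

Lemma arcsinh_increment_le p q x y : 0 < p -> 0 <= q -> 0 <= x -> x <= y ->
  arcsinh_pq p q y - arcsinh_pq p q x <= arcsinh_density p q x * (y - x).
Proof.
move=> p0 q0 x0 xy.
apply: (primitive_le_linear (primitive_arcsinh q p0 (le_trans x0 xy))
  x0 xy (lexx y)).
by move=> z /andP[xz zy]; apply: arcsinh_density_anti => //; exact: ltW.
Qed.

(** Used with an exponent q slightly above 1, where t `^ q is almost linear; the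
    density (1 + a * t) `^ (- 2^-1) has an elementary primitive. *)
Lemma arcsinh_ge_sqrt q a x : 0 < q -> 0 < a -> 0 <= x ->
  (forall z, 0 < z < x -> z `^ q <= a * z) ->
  2 / a * (Num.sqrt (1 + a * x) - 1) <= arcsinh_pq 2 q x.
Proof.
move=> q0 a0 x0 za; have p0 : 0 < 2 :> R by [].
pose S : R -> R := fun t => 2 / a * (Num.sqrt (1 + a * t) - 1).
have PS : primitive x S (fun t => (1 + a * t) `^ (- 2^-1)).
  apply: primitive_of_derive; first by rewrite /S mulr0 addr0 sqrtr1 subrr mulr0.
  move=> t /andP[t0 tx].
  have B0 : 0 < 1 + a * t by rewrite ltr_pwDl// mulr_ge0// ltW.
  have d1 : is_derive t 1 (fun u : R => 1 + a * u) a.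
    have d := is_deriveD (is_derive_cst (1 : R) t 1)
      (is_deriveM (is_derive_cst (a : R) t 1) (is_derive_id t 1)).
    by apply: is_derive_eq d _; rewrite scaler0 addr0 add0r /GRing.scale/= mulr1.
  have d2 := is_derive1_comp (f := @Num.sqrt R) (g := fun u : R => 1 + a * u)
    (is_derive1_sqrt B0) d1.
  have d := is_deriveM (is_derive_cst (2 / a : R) t 1)
    (is_deriveB d2 (is_derive_cst (1 : R) t 1)).
  apply: is_derive_eq d _.
  rewrite scaler0 addr0 subr0 /GRing.scale/= powRN_half ?(ltW B0)//.
  have an : a != 0 by rewrite gt_eqF.
  have : Num.sqrt (1 + a * t) != 0 by rewrite gt_eqF// sqrtr_gt0.
  by set Q := Num.sqrt _ => Qn; field; rewrite Qn.
apply: (primitive_leq0 PS (primitive_arcsinh q p0 x0) x0) => z /[dup] zx /andP[z0 _].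
apply: powR_leN => //; first by rewrite ltr_pwDl ?powR_ge0.
by rewrite lerD2l za.
Qed.

End Estimates.

(** * Failure of monotonicity in p *)

Section NonMonotonicity.
Variable R : realType.
Implicit Types (a b c p q s t u v x y z w X : R) (n : nat).

Lemma not_monotonic_peak (D : set R) (f : R -> R) a b c :
  D a -> D b -> D c -> a < b -> b < c -> f a < f b -> f c < f b ->
  ~ monotonic_on D f.
Proof.
move=> Da Db Dc ab bc fab fcb [] H.
  have := H b c; rewrite !inE => /(_ Db Dc (ltW bc)).
  by rewrite leNgt fcb.
have := H b a; rewrite !inE => /(_ Db Da (ltW ab)).
by rewrite leNgt fab.
Qed.

Lemma not_monotonic_dip (D : set R) (f : R -> R) a b c :
  D a -> D b -> D c -> a < b -> b < c -> f b < f a -> f b < f c ->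
  ~ monotonic_on D f.
Proof.
move=> Da Db Dc ab bc fba fbc [] H.
  have := H a b; rewrite !inE => /(_ Da Db (ltW ab)).
  by rewrite leNgt fba.
have := H c b; rewrite !inE => /(_ Dc Db (ltW bc)).
by rewrite leNgt fbc.
Qed.

Lemma arcsin_solve p q X y : 1 < p -> 1 < q -> 0 < y -> 0 < X < 1 ->
  y <= arcsin_pq p q X ->
  exists x, [/\ 0 < x < 1, x <= X & arcsin_pq p q x = y].
Proof.
move=> p1 q1 y0 /andP[X0 X1] yX.
have oo : 0 <= (1 : R) <= 1 by apply/andP; split.
have [|x x01 E] := primitive_ivt (y := y) (primitive_arcsin p1 (ltW q1) oo) _ ltr01.
  by rewrite y0/= (le_lt_trans yX)// arcsin_lt// ltW.
exists x; split=> //; rewrite leNgt; apply/negP => Xx.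
have := arcsin_lt p1 q1 (ltW X0) Xx (ltW (andP x01).2).
by rewrite E ltNge yX.
Qed.

Lemma arcsin_le_inv p q X x : 1 < p -> 1 < q -> X <= 1 -> 0 <= x ->
  arcsin_pq p q X <= arcsin_pq p q x -> X <= x.
Proof.
move=> p1 q1 X1 x0; rewrite leNgt => H; rewrite leNgt; apply: contra H => xX.
exact: arcsin_lt.
Qed.

Lemma arcsinh_solve p q X y : 1 < p -> 1 < q -> 0 < y -> 0 < X ->
  y < arcsinh_pq p q X -> exists2 x, 0 < x & arcsinh_pq p q x = y.
Proof.
move=> p1 q1 y0 X0 yX.
have [|x /andP[x0 _] E] := primitive_ivt (y := y)
  (primitive_arcsinh q (lt_trans ltr01 p1) (ltW X0)) _ X0.
  by rewrite y0.
by exists x.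
Qed.

Lemma arcsinh_le_inv p q X x : 1 < p -> 1 < q -> 0 <= x ->
  arcsinh_pq p q X <= arcsinh_pq p q x -> X <= x.
Proof.
move=> p1 q1 x0; rewrite leNgt => H; rewrite leNgt; apply: contra H => xX.
exact: arcsinh_lt.
Qed.

Lemma bernoulli_ineq n a : 0 <= a -> 1 + n%:R * a <= (1 + a) ^+ n.
Proof.
move=> a0; elim: n => [|n IH]; first by rewrite mul0r addr0 expr0.
rewrite exprS; apply: (@le_trans _ _ ((1 + a) * (1 + n%:R * a))).
  rewrite -natr1; have : 0 <= n%:R :> R by [].
  by set N := n%:R => N0; nra.
by rewrite ler_wpM2l// addr_ge0.
Qed.

(** For p = 16 and q = 2 the 16th power of cos is 1 - sin ^+ 2. The constant
    199 / 10000 is 1 - (99 / 100) ^+ 2, well above 2 ^- 8. *)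
Lemma ltr_of_pow16 u c : 0 <= u -> 0 <= c -> u ^+ 2 <= 2^-1 ->
  199 / 10000 <= c ^+ 16 -> u < c.
Proof.
move=> u0 c0 u2 c16; rewrite ltNge; apply/negP => cu.
have h1 : c ^+ 16 <= u ^+ 16 by rewrite lerXn2r ?nnegrE.
have h2 : (u ^+ 2) ^+ 8 <= (2^-1) ^+ 8.
  by rewrite lerXn2r ?nnegrE ?exprn_ge0.
move: h2; rewrite -exprM => h2.
suff : (2^-1 : R) ^+ 8 < 199 / 10000 by move: h1 h2 c16; lra.
by lra.
Qed.

(** Take q = 2 and y in [1, 1.005]. For p = 2 the cosine is the usual one and
    its square is at most 1/2. For p = 16 the sine is still at most 99/100, and
    the 16th root lifts 1 - sin ^+ 2, at least 0.0199, above 3/4. For p = 201 the number y is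
    chosen so close to pi_pq / 2 that the cosine is back at 1/2. The values at
    p = 2, 16, 201 therefore go up and then down. *)
Lemma cos_p_not_monotonic : exists y q : R, [/\ 0 < y, 1 < q &
  ~ monotonic_on [set p | 1 < p /\ sin_dom p q y] (fun p => cos_pq p q y)].
Proof.
(* With this e the cosine for p = 201 at arcsin (sqrt (1 - e)) is e `^ 201^-1. *)
pose e : R := 2^-1 ^+ 201.
have e0 : 0 < e by rewrite exprn_gt0.
have e1 : e <= 2048^-1.
  have -> : 2048^-1 = 2^-1 ^+ 11 :> R by lra.
  rewrite /e -[201%N]/(190 + 11)%N exprD.
  apply: ler_piMl; first by rewrite exprn_ge0.
  by apply: exprn_ile1; lra.
have e201 : e `^ (201)^-1 = 2^-1.
  by rewrite /e -powR_mulrn// -powRrM mulfV// powRr1.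
clearbody e.
pose x3 := Num.sqrt (1 - e).
have x3e : x3 ^+ 2 = 1 - e by rewrite sqr_sqrtr//; lra.
have x30 : 0 < x3 by rewrite sqrtr_gt0; lra.
clearbody x3.
have x31 : x3 < 1.
  by rewrite -(@ltr_pXn2r _ 2)// ?nnegrE ?(ltW x30)// x3e expr1n; lra.
have x3in : 0 < x3 < 1 by rewrite x30.
have h201 : 1 < 201 :> R by rewrite ltr1n.
have h16 : 1 < 16 :> R by rewrite ltr1n.
have h2 : 1 < 2 :> R by rewrite ltr1n.
have [y E3] : exists y, arcsin_pq 201 2 x3 = y by eexists.
have y1 : 1 <= y.
  rewrite -E3; apply: le_trans (arcsin_ge_poly (n := 2) h201 isT _); last by rewrite !ltW.
  have x3l : 1 - e <= x3 by rewrite -x3e expr2 ler_piMl// ltW.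
  have x3c : x3 ^+ 3 = x3 * (1 - e) by rewrite -x3e; ring.
  by rewrite x3c; nra.
have y2 : y <= 201 / 200.
  rewrite -E3; have x3in' : 0 <= x3 < 1 by rewrite x31 ltW.
  apply: (le_trans (arcsin_le_pow h201 (ltW h2) x3in')).
  have -> : 201 / 200 = (1 - 201^-1)^-1 :> R.
    by clear; rewrite -invf_div; congr (_^-1); lra.
  apply: ler_piMr; first by clear; rewrite invr_ge0; lra.
  by rewrite gerBl powR_ge0.
have y0 : 0 < y by exact: lt_le_trans y1.
have X01 : 0 < (99 / 100 : R) < 1 by clear; apply/andP; split; lra.
have X01' : 0 <= (99 / 100 : R) <= 1 by clear; apply/andP; split; lra.
have [x1 [x1in _ E1]] : exists x, [/\ 0 < x < 1, x <= 99 / 100 & arcsin_pq 2 2 x = y].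
  apply: arcsin_solve => //; apply: (le_trans y2).
  by apply: le_trans (arcsin_ge_poly (n := 2) h2 isT X01'); clear; lra.
have [x2 [x2in x2l E2]] : exists x, [/\ 0 < x < 1, x <= 99 / 100 & arcsin_pq 16 2 x = y].
  apply: arcsin_solve => //; apply: (le_trans y2).
  by apply: le_trans (arcsin_ge_poly (n := 2) h16 isT X01'); clear; lra.
have [x10 x11] := andP x1in; have [x20 x21] := andP x2in.
have c1E : cos_pq 2 2 y = Num.sqrt (1 - x1 ^+ 2).
  by rewrite -E1 cos_arcsin// powR_mulrn ?(ltW x10)// powR12_sqrt// subr_ge0 expr_le1// ltW.
have c2E : cos_pq 16 2 y = (1 - x2 ^+ 2) `^ 16^-1.
  by rewrite -E2 cos_arcsin// powR_mulrn ?(ltW x20).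
have c3E : cos_pq 201 2 y = 2^-1.
  by rewrite -E3 cos_arcsin// powR_mulrn ?(ltW x30)// x3e opprB addrC subrK.
have c2p : 199 / 10000 <= cos_pq 16 2 y ^+ 16.
  have B0 : 0 <= 1 - x2 ^+ 2 by rewrite subr_ge0 expr_le1// ltW.
  rewrite c2E -powR_mulrn ?powR_ge0// -powRrM mulVf ?powRr1//.
  have x2s : x2 ^+ 2 <= (99 / 100) ^+ 2.
    by apply: lerXn2r => //; rewrite nnegrE; [exact: ltW|clear; lra].
  by clear - x2s; lra.
have c20 : 0 <= cos_pq 16 2 y by rewrite c2E powR_ge0.
exists y, 2; split => //.
apply: (@not_monotonic_peak _ _ 2 16 201); rewrite ?ltr_nat//=.
- by split=> //; rewrite -E1; apply: sin_dom_arcsin.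
- by split=> //; rewrite -E2; apply: sin_dom_arcsin.
- by split=> //; rewrite -E3; apply: sin_dom_arcsin.
- apply: (ltr_of_pow16 _ c20 _ c2p); first by rewrite c1E sqrtr_ge0.
  have B0 : 0 < 1 - x1 ^+ 2 by rewrite subr_gt0 expr_lt1// ltW.
  (* The density increases, so 1 <= y <= x1 / sqrt (1 - x1 ^+ 2). *)
  have cx : Num.sqrt (1 - x1 ^+ 2) <= x1.
    have q20 : 0 < 2 :> R by [].
    have oo : 0 <= x1 <= 1 by rewrite !ltW.
    have := primitive_le_linear (c := arcsin_density 2 2 x1)
      (primitive_arcsin h2 (ltW h2) oo) (lexx 0) (ltW x10) (lexx x1).
    rewrite E1 arcsin0// !subr0.
    have H z : 0 < z < x1 -> arcsin_density 2 2 z <= arcsin_density 2 2 x1.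
      by move=> /andP[z0 zx]; rewrite arcsin_density_le// ltW.
    move=> /(_ H) /(le_trans y1).
    rewrite /arcsin_density powR_mulrn ?(ltW x10)// powRN_half ?(ltW B0)//.
    by rewrite mulrC ler_pdivlMr ?sqrtr_gt0// mul1r.
  have : Num.sqrt (1 - x1 ^+ 2) ^+ 2 <= x1 ^+ 2.
    by rewrite lerXn2r ?nnegrE ?sqrtr_ge0// ltW.
  rewrite c1E sqr_sqrtr ?(ltW B0)// => h.
  by clear - h; lra.
- by apply: (ltr_of_pow16 _ c20 _ c2p); rewrite c3E; clear; lra.
Qed.

End NonMonotonicity.

(** * Failure of monotonicity in q *)

Section NonMonotonicityInQ.
Variable R : realType.
Implicit Types (a b c p q s t u v x y z w X : R) (n : nat).

Lemma one_lt_two : 1 < 2 :> R. Proof. by rewrite ltr1n. Qed.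
Lemma one_lt_33_32 : 1 < 33 / 32 :> R. Proof. lra. Qed.

Lemma pow_33_32_ge : 7425 / 10000 <= (3 / 4 : R) `^ (33 / 32).
Proof.
have a0 : 0 < 3 / 4 :> R by lra.
have -> : 33 / 32 = 1 + 32^-1 :> R by lra.
rewrite powRD; last by rewrite (gt_eqF a0) implybT.
rewrite powRr1 ?(ltW a0)//.
have h : (99 / 100) ^+ 32 <= 3 / 4 :> R by lra.
have k : 99 / 100 <= (3 / 4 : R) `^ 32^-1.
  have -> : 99 / 100 = ((99 / 100) ^+ 32) `^ 32^-1 :> R.
    by rewrite -powR_mulrn -?powRrM ?mulfV ?powRr1//; lra.
  by apply: ge0_ler_powR h; rewrite ?nnegrE ?exprn_ge0 ?invr_ge0//; lra.
by move: k; set A := _ `^ _; lra.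
Qed.

Lemma pow_33_32_le z : 0 < z <= 5 / 4 -> z `^ (33 / 32) <= 101 / 100 * z.
Proof.
move=> /andP[z0 z1].
have -> : 33 / 32 = 1 + 32^-1 :> R by lra.
rewrite powRD; last by rewrite (gt_eqF z0) implybT.
rewrite powRr1 ?(ltW z0)// mulrC ler_pM2r//.
have h : z <= (101 / 100) ^+ 32 by lra.
have -> : 101 / 100 = ((101 / 100) ^+ 32) `^ 32^-1 :> R.
  by rewrite -powR_mulrn -?powRrM ?mulfV ?powRr1//; lra.
by apply: ge0_ler_powR h; rewrite ?nnegrE ?exprn_ge0 ?invr_ge0 ?(ltW z0)//; lra.
Qed.

(** A lower bound for 2 ^ n that can be used at a large n without computing the
    power. *)
Lemma four_mul_le_two_pow n : (5 <= n)%N -> (4 * n.+1 <= 2 ^ n)%N.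
Proof.
elim: n => // n IH; rewrite leq_eqVlt => /predU1P[<-//|/IH h].
by rewrite expnS; apply: leq_trans (leq_mul (leqnn 2) h); rewrite mulnCA leq_mul2l mul2n -addnn addnS !addSn !ltnS leq_addl.
Qed.

(** The common source of the examples for cos and tam, with p = 2 and y in
    [1, 1.002]. For q = 33/32 the density is close to (1 - t) `^ (- 2^-1), whose
    primitive takes the value 1 at 3/4, so the solution is at least 3/4. For
    q = 8 the solution is at most 26/27, and its 8th power falls just below
    the (33/32)-th power of the first one. For a large q the number y is chosen such that tam
    equals 2; then x3 `^ q3 is close to 1. *)
Lemma sin_q_witnesses : exists y x1 x2 x3 q3,
  [/\ 0 < y, 8 < q3 &
   [/\ 0 < x1 < 1, 0 < x2 < 1 & 0 < x3 < 1] /\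
   [/\ arcsin_pq 2 (33 / 32) x1 = y, arcsin_pq 2 8 x2 = y &
       arcsin_pq 2 q3 x3 = y] /\
   [/\ 7425 / 10000 <= x1 `^ (33 / 32), x2 `^ 8 <= 7395 / 10000 &
       x3 `^ q3 = (1 + (2 `^ q3)^-1)^-1]].
Proof.
have [n n1000 n2] : exists2 n, (1000 <= n.+1)%N & (4 * n.+2 <= 2 ^ n.+1)%N.
  by exists 999%N; [|exact: (@four_mul_le_two_pow 1000)].
have q1000 : 1000 <= n.+1%:R :> R by rewrite ler_nat.
pose N : R := n.+1%:R.
have qn : 4 * (N + 1) <= 2 ^+ n.+1 :> R.
  by rewrite natr1 -natrX -natrM ler_nat.
have N8 : 8 < N by apply: lt_le_trans q1000; rewrite ltr_nat.
have N1 : 1 < N by apply: lt_trans N8; rewrite ltr1n.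
have N0 : 0 < N by exact: lt_trans N1.
pose d : R := (2 ^+ n.+1)^-1.
have d0 : 0 < d by rewrite invr_gt0 exprn_gt0.
have dN : d * (4 * (N + 1)) <= 1.
  by rewrite mulrC ler_pdivrMr ?exprn_gt0// mul1r.
pose v := (1 + d)^-1.
have v0 : 0 < v by rewrite invr_gt0 addr_gt0.
have v1 : v < 1 by rewrite invf_lt1 ?addr_gt0// ltrDl.
have vd : 1 - d <= v.
  rewrite -[leRHS]mul1r ler_pdivlMr ?addr_gt0//.
  by rewrite mulrDr mulr1 mulrBl mul1r; have := sqr_ge0 d; rewrite expr2; lra.
pose x3 := v `^ N^-1.
have x3N : x3 `^ N = v by rewrite /x3 -powRrM mulVf ?gt_eqF// powRr1// ltW.
have x30 : 0 < x3 by rewrite powR_gt0.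
have x31 : x3 < 1 by apply: powR_lt1; rewrite ?invr_gt0 ?(ltW v0).
have x3v : v <= x3.
  by apply: ger1_powR; rewrite ?v0 ?(ltW v1)// invf_le1// ltW.
have x3in : 0 < x3 < 1 by rewrite x30.
have x3in' : 0 <= x3 <= 1 by rewrite !ltW.
have x3in'' : 0 <= x3 < 1 by rewrite ltW.
have x3n : x3 ^+ n.+1 = v by rewrite -powR_mulrn// ltW.
clearbody x3.
have [y E3] : exists y, arcsin_pq 2 N x3 = y by eexists.
have y1 : 1 <= y.
  rewrite -E3; apply: le_trans (arcsin_ge_poly (n := n.+1) one_lt_two isT x3in').
  rewrite exprS x3n -[n.+2%:R]natr1 -/N.
  (* The gain 1 / (4 (N + 1)) of the lower bound for arcsin outweighs the
     loss d incurred by replacing x3 by 1. *)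
  have dNs : d <= 2^-1 / (N + 1) * 2^-1.
    by move: dN; rewrite -ler_pdivlMr; [move: (N) N0 => M M0; rewrite invfM; lra|lra].
  have dh : d <= 16^-1 by move: dN d0 q1000; rewrite -/N; clear; nra.
  have vv : 2^-1 <= x3 * v by move: dh d0 vd x3v; clear; nra.
  have N10 : 0 <= (N + 1)^-1 by rewrite invr_ge0; lra.
  have := ler_wpM2r N10 vv.
  by move: dNs vd x3v; clear; set A := (N + 1)^-1; set B := x3 * v; lra.
have y2 : y <= 1002 / 1000.
  rewrite -E3; apply: (le_trans (arcsin_le_tail n one_lt_two x3in'')).
  have -> : (1 - 2^-1)^-1 = 2 :> R by rewrite -[RHS]invrK; congr (_^-1); lra.
  have : 2 / n.+1%:R <= 2 / 1000 :> R by rewrite ler_pM2l// lef_pV2// posrE ltr0n.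
  by move: x31; clear; set A := 2 / n.+1%:R; lra.
have y0 : 0 < y by exact: lt_le_trans y1.
have h8 : 1 < 8 :> R by rewrite ltr1n.
have [x1 [x1in x1l E1]] : exists x,
    [/\ 0 < x < 1, x <= x3 & arcsin_pq 2 (33 / 32) x = y].
  apply: (arcsin_solve one_lt_two one_lt_33_32 y0 x3in); rewrite -E3.
  apply: (primitive_leq0 (primitive_arcsin one_lt_two (ltW N1) x3in')
    (primitive_arcsin one_lt_two (ltW one_lt_33_32) x3in') (ltW x30)).
  move=> z /andP[z0 zx]; have z1 := lt_trans zx x31.
  apply: powR_leN; first by rewrite invr_ge0.
    by rewrite arcsin_density_base_gt0 ?(ltW z0)//; clear; lra.
  rewrite lerD2l lerN2; apply: ger_powR; first by rewrite z0 ltW.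
  by apply: ltW; apply: lt_trans N8; clear; lra.
have [x2 [x2in x2l E2]] : exists x,
    [/\ 0 < x < 1, x <= 26 / 27 & arcsin_pq 2 8 x = y].
  apply: (arcsin_solve one_lt_two h8 y0); first by clear; apply/andP; split; lra.
  apply: (le_trans y2).
  apply: le_trans (arcsin_ge_poly (n := 8) one_lt_two isT _); clear; first by lra.
  by apply/andP; split; lra.
have [x10 x11] := andP x1in; have [x20 x21] := andP x2in.
exists y, x1, x2, x3, N; split=> //; split; first by split.
split; first by split.
split.
- apply: (le_trans pow_33_32_ge); apply: ge0_ler_powR.
  + by clear; lra.
  + by rewrite nnegrE; clear; lra.
  + by rewrite nnegrE ltW.
  apply: (arcsin_le_inv one_lt_two one_lt_33_32) => //; [by clear; lra|exact: ltW|].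
  rewrite E1; apply: le_trans y1.
  have h34 : 0 <= (3 / 4 : R) < 1 by clear; apply/andP; split; lra.
  apply: (le_trans (arcsin_le_pow one_lt_two (ltW one_lt_33_32) h34)).
  have -> : 1 - 2^-1 = 2^-1 :> R by clear; lra.
  have -> : 1 - 3 / 4 = (2^-1) ^+ 2 :> R by clear; lra.
  rewrite powR12_sqrt ?exprn_ge0// sqrtr_sqr ger0_norm// invrK.
  by clear; lra.
- rewrite powR_mulrn ?(ltW x20)//.
  apply: (@le_trans _ _ ((26 / 27) ^+ 8)); last by clear; lra.
  by apply: lerXn2r => //; rewrite nnegrE; [exact: ltW|clear; lra].
- by rewrite x3N /v /d -powR_mulrn.
Qed.

Lemma lt_33_32_8 : (33 / 32 : R) < 8. Proof. lra. Qed.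

(** The values of 1 - cos ^+ 2 at q = 33/32, 8, q3 are at least 0.7425, at most
    0.7395, and at least 0.8. *)
Lemma cos_q_not_monotonic : exists y p : R, [/\ 0 < y, 1 < p &
  ~ monotonic_on [set q | 1 < q /\ sin_dom p q y] (fun q => cos_pq p q y)].
Proof.
have [y [x1 [x2 [x3 [q3 [y0 q38 [[x1in x2in x3in] [[E1 E2 E3] [u1 u2 u3]]]]]]]]] :=
  sin_q_witnesses.
have h8 : 1 < 8 :> R by rewrite ltr1n.
have h3 := lt_trans h8 q38.
have q30 := lt_trans ltr01 h3.
exists y, 2; split; [exact: y0|exact: one_lt_two|].
have P : 0 < (2 : R) `^ q3 by rewrite powR_gt0.
have P4 : 4 <= 2 `^ q3.
  have -> : 4 = 2 `^ 2%:R :> R by clear; rewrite powR_mulrn//; lra.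
  by apply: ler_powR; [exact: ltW one_lt_two|apply: ltW; apply: lt_trans q38; rewrite ltr_nat].
have u3l : 8 / 10 <= x3 `^ q3.
  rewrite u3 [leLHS](_ : _ = (1 + 4^-1)^-1); last first.
    clear; have -> : 1 + 4^-1 = 5 / 4 :> R by lra.
    by rewrite invf_div; lra.
  rewrite lef_pV2 ?posrE ?addr_gt0 ?invr_gt0//.
  by rewrite lerD2l lef_pV2 ?posrE.
have half0 : 0 < 2^-1 :> R by rewrite invr_gt0.
have c1E : cos_pq 2 (33 / 32) y = (1 - x1 `^ (33 / 32)) `^ 2^-1.
  by rewrite -E1; exact: (cos_arcsin one_lt_two one_lt_33_32 x1in).
have c2E : cos_pq 2 8 y = (1 - x2 `^ 8) `^ 2^-1.
  by rewrite -E2; exact: (cos_arcsin one_lt_two h8 x2in).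
have c3E : cos_pq 2 q3 y = (1 - x3 `^ q3) `^ 2^-1.
  by rewrite -E3; exact: (cos_arcsin one_lt_two h3 x3in).
have D1 : sin_dom 2 (33 / 32) y.
  by rewrite -E1; exact: (sin_dom_arcsin one_lt_two one_lt_33_32 x1in).
have D2 : sin_dom 2 8 y by rewrite -E2; exact: (sin_dom_arcsin one_lt_two h8 x2in).
have D3 : sin_dom 2 q3 y by rewrite -E3; exact: (sin_dom_arcsin one_lt_two h3 x3in).
have b1 : 0 < 1 - x1 `^ (33 / 32).
  have [x10 x11] := andP x1in.
  by rewrite arcsin_density_base_gt0 ?(ltW x10)//; clear; lra.
have b3 : 0 < 1 - x3 `^ q3.
  have [x30 x31] := andP x3in.
  by rewrite arcsin_density_base_gt0 ?(ltW x30).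
apply: (not_monotonic_peak _ _ _ lt_33_32_8 q38).
- by split; [exact: one_lt_33_32|exact: D1].
- by split; [exact: h8|exact: D2].
- by split; [exact: h3|exact: D3].
- rewrite c1E c2E; apply: (gt0_ltr_powR half0).
  + by rewrite nnegrE ltW.
  + by rewrite nnegrE; move: u2; clear; lra.
  + by move: u1 u2; clear; lra.
- rewrite c2E c3E; apply: (gt0_ltr_powR half0).
  + by rewrite nnegrE ltW.
  + by rewrite nnegrE; move: u2; clear; lra.
  + by move: u3l u2; clear; lra.
Qed.

(** For q = 33/32 tam is at least 288/100 to the power 32/33; for q = 8 it is at
    most the 8th root of 286/100; for q3 it equals 2 by the choice of y. *)
Lemma tam_q_not_monotonic : exists y p : R, [/\ 0 < y, 1 < p &
  ~ monotonic_on [set q | 1 < q /\ tam_dom p q y] (fun q => tam_pq p q y)].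
Proof.
have [y [x1 [x2 [x3 [q3 [y0 q38 [[x1in x2in x3in] [[E1 E2 E3] [u1 u2 u3]]]]]]]]] :=
  sin_q_witnesses.
have h8 : 1 < 8 :> R by rewrite ltr1n.
have h3 := lt_trans h8 q38.
have q30 := lt_trans ltr01 h3.
have P : 0 < (2 : R) `^ q3 by rewrite powR_gt0.
have [[x10 x11] [x20 x21] [x30 x31]] := And3 (andP x1in) (andP x2in) (andP x3in).
have b1 : 0 < 1 - x1 `^ (33 / 32).
  by rewrite arcsin_density_base_gt0 ?(ltW x10)//; clear; lra.
have b2 : 0 < 1 - x2 `^ 8 by rewrite arcsin_density_base_gt0 ?(ltW x20).
have b3 : 0 < 1 - x3 `^ q3 by rewrite arcsin_density_base_gt0 ?(ltW x30).
have t1E : tam_pq 2 (33 / 32) y =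
    (x1 `^ (33 / 32) / (1 - x1 `^ (33 / 32))) `^ (33 / 32)^-1.
  rewrite -E1 (tam_arcsin one_lt_two one_lt_33_32 x1in).
  exact: (divr_powR_invE (lt_trans ltr01 one_lt_33_32) x10 b1).
have t2E : tam_pq 2 8 y = (x2 `^ 8 / (1 - x2 `^ 8)) `^ 8^-1.
  rewrite -E2 (tam_arcsin one_lt_two h8 x2in).
  exact: (divr_powR_invE (lt_trans ltr01 h8) x20 b2).
have t3E : tam_pq 2 q3 y = 2.
  rewrite -E3 (tam_arcsin one_lt_two h3 x3in) (divr_powR_invE q30 x30 b3) u3.
  have -> : (1 + (2 `^ q3)^-1)^-1 / (1 - (1 + (2 `^ q3)^-1)^-1) = 2 `^ q3 :> R.
    move: P; set A := 2 `^ q3 => A0; field.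
    by apply/andP; split; rewrite gt_eqF//; move: A0; clear; lra.
  by rewrite -powRrM mulfV ?powRr1// gt_eqF.
have D1 : tam_dom 2 (33 / 32) y.
  by rewrite -E1; exact: (tam_dom_arcsin one_lt_two one_lt_33_32 x1in).
have D2 : tam_dom 2 8 y by rewrite -E2; exact: (tam_dom_arcsin one_lt_two h8 x2in).
have D3 : tam_dom 2 q3 y by rewrite -E3; exact: (tam_dom_arcsin one_lt_two h3 x3in).
have r2 : x2 `^ 8 / (1 - x2 `^ 8) <= 286 / 100.
  by rewrite ler_pdivrMr//; move: u2; clear; lra.
have r20 : 0 <= x2 `^ 8 / (1 - x2 `^ 8) by rewrite divr_ge0 ?powR_ge0// ltW.
have r1 : 288 / 100 <= x1 `^ (33 / 32) / (1 - x1 `^ (33 / 32)).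
  by rewrite ler_pdivlMr//; move: u1; clear; lra.
exists y, 2; split; [exact: y0|exact: one_lt_two|].
apply: (not_monotonic_dip _ _ _ lt_33_32_8 q38).
- by split; [exact: one_lt_33_32|exact: D1].
- by split; [exact: h8|exact: D2].
- by split; [exact: h3|exact: D3].
- rewrite t1E t2E.
  apply: (@lt_trans _ _ ((x1 `^ (33 / 32) / (1 - x1 `^ (33 / 32))) `^ 8^-1)).
    apply: gt0_ltr_powR; rewrite ?invr_gt0//.
    + by rewrite nnegrE; move: r1; clear; lra.
    + by move: r1 r2; clear; lra.
  apply: gt1_lt_powR; first by move: r1; clear; lra.
  by clear; rewrite ltf_pV2 ?posrE; lra.
- rewrite t2E t3E.
  have -> : 2 = (2 `^ 8) `^ 8^-1 :> R by rewrite -powRrM mulfV ?powRr1.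
  apply: gt0_ltr_powR; rewrite ?invr_gt0//.
  + by rewrite nnegrE powR_ge0.
  + by rewrite [ltRHS]powR_mulrn//; move: r2; clear; lra.
Qed.

Lemma powRN_half_ge v c : 0 < v -> 0 < c -> v <= c ^+ 2 ->
  c^-1 <= v `^ (- 2^-1).
Proof.
move=> v0 c0 vc; have := powR_leN (q := 2^-1) _ v0 vc.
rewrite (powRN_half (v := c ^+ 2)) ?exprn_ge0 ?(ltW c0)// sqrtr_sqr gtr0_norm//; apply.
by rewrite invr_ge0.
Qed.

Lemma powRN_half_le v c : 0 < c -> c ^+ 2 <= v ->
  v `^ (- 2^-1) <= c^-1.
Proof.
move=> c0 vc; have := powR_leN (q := 2^-1) _ (exprn_gt0 2 c0) vc.
rewrite (powRN_half (v := c ^+ 2)) ?exprn_ge0 ?(ltW c0)// sqrtr_sqr gtr0_norm//; apply.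
by rewrite invr_ge0.
Qed.

(** Take p = 2 and y = 0.998. For q = 33/32 the solution is at most 5/4, with
    q-th power at most 1.2625. For q = 8 it exceeds 1, and its 8th power is at
    least 1.29. For q = 300 the solution is at most 1, so that cosh ^+ 2 is at most 2. *)
Lemma cosh_q_not_monotonic : exists y p : R, [/\ 0 < y, 1 < p &
  ~ monotonic_on [set q | 1 < q /\ sinh_dom p q y] (fun q => cosh_pq p q y)].
Proof.
have h8 : 1 < 8 :> R by rewrite ltr1n.
have h300 : 1 < 300 :> R by rewrite ltr1n.
have [y Ey] : exists y : R, y = 998 / 1000 by eexists.
have y01 : 0 < y < 1 by rewrite Ey; clear; apply/andP; split; lra.
have [y0 _] := andP y01.
have [x1 x10 E1] := arcsinh_exists one_lt_two one_lt_33_32 y01.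
have [x2 x20 E2] := arcsinh_exists one_lt_two h8 y01.
have [x3 x30 E3] := arcsinh_exists one_lt_two h300 y01.
have u1 : x1 `^ (33 / 32) <= 12625 / 10000.
  have x1l : x1 <= 5 / 4.
    apply: (arcsinh_le_inv one_lt_two one_lt_33_32); first by clear; lra.
    rewrite E1 Ey.
    apply: le_trans (arcsinh_ge_sqrt (a := 101 / 100) _ _ _ _); last first.
    - move=> z /andP[z0 z1]; apply: pow_33_32_le; by rewrite z0 ltW.
    - by clear; lra.
    - by clear; lra.
    - by clear; lra.
    (* 1 + (101 / 100) (5 / 4) = 2.2625, and 1.504 ^+ 2 = 2.262016. *)
    have : 1504 / 1000 <= Num.sqrt (1 + 101 / 100 * (5 / 4)) :> R.
      rewrite -[leLHS]ger0_norm; last by clear; lra.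
      by rewrite -sqrtr_sqr; apply: ler_wsqrtr; clear; lra.
    set S := Num.sqrt _.
    have -> : 2 / (101 / 100) = 200 / 101 :> R by clear; field.
    by clear; lra.
  apply: (@le_trans _ _ ((5 / 4) `^ (33 / 32))).
    apply: ge0_ler_powR x1l; rewrite ?nnegrE ?(ltW x10)//; clear; lra.
  apply: le_trans (pow_33_32_le _) _; clear; last by lra.
  by apply/andP; split; lra.
have u2 : 129 / 100 <= x2 `^ 8.
  have x2l : 31 / 30 <= x2.
    apply: (arcsinh_le_inv one_lt_two h8 (ltW x20)); rewrite E2 Ey.
    apply: le_trans (arcsinh_le_poly 8 _) _; clear; first by lra.
    by rewrite -[8.+1]/9%N -[(8 * 2).+1]/17%N; lra.
  rewrite powR_mulrn ?(ltW x20)//.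
  apply: (@le_trans _ _ ((31 / 30) ^+ 8)); first by clear; lra.
  by apply: lerXn2r => //; rewrite nnegrE; [clear; lra|exact: ltW].
have u3 : x3 `^ 300 <= 1.
  apply: powR_le1; first exact: ltW (lt_trans ltr01 h300).
  rewrite (ltW x30) andTb; apply: (arcsinh_le_inv one_lt_two h300); first exact: ler01.
  rewrite E3 Ey; apply: le_trans (arcsinh_ge_poly 300 one_lt_two ler01).
  by clear; rewrite expr1n; lra.
have half0 : 0 < 2^-1 :> R by rewrite invr_gt0.
have c1E : cosh_pq 2 (33 / 32) y = (1 + x1 `^ (33 / 32)) `^ 2^-1.
  by rewrite -E1; exact: (cosh_arcsinh _ one_lt_two x10).
have c2E : cosh_pq 2 8 y = (1 + x2 `^ 8) `^ 2^-1.
  by rewrite -E2; exact: (cosh_arcsinh _ one_lt_two x20).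
have c3E : cosh_pq 2 300 y = (1 + x3 `^ 300) `^ 2^-1.
  by rewrite -E3; exact: (cosh_arcsinh _ one_lt_two x30).
have D1 : sinh_dom 2 (33 / 32) y.
  by rewrite -E1; exact: (sinh_dom_arcsinh _ one_lt_two x10).
have D2 : sinh_dom 2 8 y by rewrite -E2; exact: (sinh_dom_arcsinh _ one_lt_two x20).
have D3 : sinh_dom 2 300 y.
  by rewrite -E3; exact: (sinh_dom_arcsinh _ one_lt_two x30).
have lt83 : 8 < 300 :> R by rewrite ltr_nat.
exists y, 2; split; [exact: y0|exact: one_lt_two|].
apply: (not_monotonic_peak _ _ _ lt_33_32_8 lt83).
- by split; [exact: one_lt_33_32|exact: D1].
- by split; [exact: h8|exact: D2].
- by split; [exact: h300|exact: D3].
- rewrite c1E c2E; apply: (gt0_ltr_powR half0).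
  + by rewrite nnegrE addr_ge0 ?powR_ge0.
  + by rewrite nnegrE addr_ge0 ?powR_ge0.
  + by move: u1 u2; clear; lra.
- rewrite c2E c3E; apply: (gt0_ltr_powR half0).
  + by rewrite nnegrE addr_ge0 ?powR_ge0.
  + by rewrite nnegrE addr_ge0 ?powR_ge0.
  + by move: u3 u2; clear; lra.
Qed.

(** Take p = 2 and, for a very large q, the number y at which sinh equals 1.09;
    for such q the density is about 1 on [0, 1] and about 0 beyond, so y is close
    to 1. For q = 2 sinh at y is still at least 1.09, whereas for q = 16 it is at
    most 1.08. *)
Lemma sinh_q_not_monotonic : exists y p : R, [/\ 0 < y, 1 < p &
  ~ monotonic_on [set q | 1 < q /\ sinh_dom p q y] (fun q => sinh_pq p q y)].
Proof.
(* The bound 10 ^+ 6 makes (501 / 500) ^+ n exceed 40 ^+ 2, by Bernoulli. *)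
have [n n6] : exists n : nat, 10 ^+ 6 <= n%:R :> R.
  exists (Num.bound (10 ^+ 6 : R)); apply: ltW; apply: archi_boundP.
  by rewrite exprn_ge0.
have h16 : 1 < 16 :> R by rewrite ltr1n.
have [N EN] : exists N : R, n%:R = N by eexists.
have n16 : 16 < N by rewrite -EN; apply: lt_le_trans n6; clear; lra.
have hN := lt_trans h16 n16.
have x30 : 0 < 109 / 100 :> R by clear; lra.
have [y E3] : exists y, arcsinh_pq 2 N (109 / 100) = y by eexists.
have yl : 99 / 100 <= y.
  have le1 : (1 : R) <= 109 / 100 by clear; lra.
  rewrite -E3; apply: le_trans (arcsinh_le N one_lt_two ler01 le1).
  rewrite -EN; apply: le_trans (arcsinh_ge_poly n one_lt_two ler01).
  rewrite expr1n mulr1.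
  have : (n.+1%:R)^-1 <= (50 : R)^-1.
    rewrite lef_pV2 ?posrE ?ltr0n//.
    apply: (@le_trans _ _ n%:R); last by rewrite ler_nat.
    by apply: le_trans n6; clear; lra.
  by clear; set A := _.+1%:R^-1; lra.
have yu : y <= 1006 / 1000.
  have le2 : (501 / 500 : R) <= 109 / 100 by clear; lra.
  have p0 : 0 <= 501 / 500 :> R by clear; lra.
  have h1 := arcsinh_le_id N one_lt_two p0.
  have h2 := arcsinh_increment_le (lt_trans ltr01 one_lt_two)
    (ltW (lt_trans ltr01 hN)) p0 le2.
  have h3 : arcsinh_density 2 N (501 / 500) <= 40^-1.
    apply: powRN_half_le; first by clear; lra.
    rewrite -EN powR_mulrn//.
    have -> : 501 / 500 = 1 + 500^-1 :> R by clear; lra.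
    have b0 : 0 <= 500^-1 :> R by clear; lra.
    have := bernoulli_ineq n b0.
    by move: n6; set B := (1 + 500^-1) ^+ n; set M := n%:R; clear; lra.
  rewrite -E3; move: h1 h2 h3.
  set A := arcsinh_pq 2 N (501 / 500); set B := arcsinh_pq 2 N _.
  by set C := arcsinh_density _ _ _; clear; nra.
have y0 : 0 < y by move: yl; clear; lra.
have [x1 x10 E1] : exists2 x, 0 < x & arcsinh_pq 2 2 x = y.
  apply: (arcsinh_solve (X := 2) one_lt_two one_lt_two y0); first by [].
  have le12 := ltW one_lt_two.
  have h1 := arcsinh_increment_ge (lt_trans ltr01 one_lt_two)
    (ltW (lt_trans ltr01 one_lt_two)) ler01 le12.
  have h2 := arcsinh_ge_poly 2 one_lt_two ler01.
  have h3 : (10 / 4)^-1 <= arcsinh_density 2 2 2 :> R.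
    by apply: powRN_half_ge; clear; rewrite ?powR_mulrn//; lra.
  move: h1 h2 h3 yu; rewrite expr1n invf_div.
  set A := arcsinh_pq 2 2 1; set B := arcsinh_pq 2 2 2.
  by set C := arcsinh_density _ _ _; clear; lra.
have [x2 x20 [x2l E2]] : exists2 x, 0 < x & x <= 108 / 100 /\ arcsinh_pq 2 16 x = y.
  have X0 : 0 < 108 / 100 :> R by clear; lra.
  have yX : y < arcsinh_pq 2 16 (108 / 100).
    have le1 : (1 : R) <= 108 / 100 by clear; lra.
    have h1 := arcsinh_increment_ge (lt_trans ltr01 one_lt_two)
      (ltW (lt_trans ltr01 h16)) ler01 le1.
    have h2 := arcsinh_ge_poly 16 one_lt_two ler01.
    (* (22 / 10) ^+ 2 = 4.84, while 1 + 1.08 ^+ 16 is about 4.43. *)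
    have h3 : (22 / 10)^-1 <= arcsinh_density 2 16 (108 / 100) :> R.
      by apply: powRN_half_ge; clear; rewrite ?powR_mulrn//; lra.
    move: h1 h2 h3 yu; rewrite expr1n invf_div.
    set A := arcsinh_pq 2 16 1; set B := arcsinh_pq 2 16 _.
    by set C := arcsinh_density _ _ _; clear; lra.
  have [x x0 E] := arcsinh_solve one_lt_two h16 y0 X0 yX.
  exists x => //; split; last exact: E.
  by apply: (arcsinh_le_inv one_lt_two h16 (ltW X0)); rewrite E ltW.
have x1l : 109 / 100 <= x1.
  apply: (arcsinh_le_inv one_lt_two one_lt_two (ltW x10)); rewrite E1.
  apply: le_trans yl; apply: le_trans (arcsinh_le_poly 2 (ltW x30)) _.
  by clear; rewrite -[2.+1]/3%N -[(2 * 2).+1]/5%N; lra.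
have s1E : sinh_pq 2 2 y = x1.
  by rewrite -E1; exact: (sinh_arcsinh _ one_lt_two x10).
have s2E : sinh_pq 2 16 y = x2.
  by rewrite -E2; exact: (sinh_arcsinh _ one_lt_two x20).
have s3E : sinh_pq 2 N y = 109 / 100.
  by rewrite -E3; exact: (sinh_arcsinh _ one_lt_two x30).
have D1 : sinh_dom 2 2 y.
  by rewrite -E1; exact: (sinh_dom_arcsinh _ one_lt_two x10).
have D2 : sinh_dom 2 16 y by rewrite -E2; exact: (sinh_dom_arcsinh _ one_lt_two x20).
have D3 : sinh_dom 2 N y by rewrite -E3; exact: (sinh_dom_arcsinh _ one_lt_two x30).
have lt2_16 : 2 < 16 :> R by rewrite ltr_nat.
exists y, 2; split; [exact: y0|exact: one_lt_two|].
apply: (not_monotonic_dip _ _ _ lt2_16 n16).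
- by split; [exact: one_lt_two|exact: D1].
- by split; [exact: h16|exact: D2].
- by split; [exact: hN|exact: D3].
- by rewrite s1E s2E; move: x1l x2l; clear; lra.
- by rewrite s2E s3E; move: x2l; clear; lra.
Qed.

End NonMonotonicityInQ.

Theorem theorem1 (R : realType) :
  (forall y q : R, 0 < y < 1 -> 1 < q ->
    [/\ {in `]1, +oo[ &, {homo (fun p => sin_pq p q y) : p1 p2 / p1 < p2}},
        {in `]1, +oo[ &, {homo (fun p => tam_pq p q y) : p1 p2 / p1 < p2}},
        {in `]1, +oo[ &, {homo (fun p => sinh_pq p q y) : p1 p2 /~ p1 < p2}},
        {in `]1, +oo[ &, {homo (fun p => cosh_pq p q y) : p1 p2 /~ p1 < p2}} &
        {in `]1, +oo[ &, {homo (fun p => tamh_pq p q y) : p1 p2 /~ p1 < p2}}]) /\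
  (forall y p : R, 0 < y < 1 -> 1 < p ->
    {in `]1, +oo[ &, {homo (fun q => sin_pq p q y) : q1 q2 / q1 < q2}} /\
    {in `]1, +oo[ &, {homo (fun q => tamh_pq p q y) : q1 q2 / q1 < q2}}) /\
  [/\ exists y q : R, [/\ 0 < y, 1 < q &
        ~ monotonic_on [set p | 1 < p /\ sin_dom p q y] (fun p => cos_pq p q y)],
      exists y p : R, [/\ 0 < y, 1 < p &
        ~ monotonic_on [set q | 1 < q /\ sin_dom p q y] (fun q => cos_pq p q y)],
      exists y p : R, [/\ 0 < y, 1 < p &
        ~ monotonic_on [set q | 1 < q /\ sinh_dom p q y] (fun q => cosh_pq p q y)],
      exists y p : R, [/\ 0 < y, 1 < p &
        ~ monotonic_on [set q | 1 < q /\ tam_dom p q y] (fun q => tam_pq p q y)] &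
      exists y p : R, [/\ 0 < y, 1 < p &
        ~ monotonic_on [set q | 1 < q /\ sinh_dom p q y] (fun q => sinh_pq p q y)]].
Proof.
have gt1 (p : R) : (p \in `]1, +oo[) = (1 < p) by rewrite in_itv/= andbT.
split; last split.
- move=> y q y01 hq; split=> p1 p2; rewrite !gt1 => hp1 hp2.
  + move=> p12; have [x1 [x2 [x1in x2in E1 E2 x12]]] := arcsin_p_solutions y01 hq hp1 p12.
    by rewrite -{1}E1 -E2 (sin_arcsin hp1 hq x1in) (sin_arcsin hp2 hq x2in).
  + exact: tam_p_lt.
  + move=> p21; have [x1 [x2 [x10 x20 E1 E2 x12]]] := arcsinh_p_solutions y01 hq hp2 p21.
    by rewrite -{1}E2 -E1 (sinh_arcsinh q hp1 x20) (sinh_arcsinh q hp2 x10).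
  + exact: cosh_p_gt.
  + exact: tamh_p_gt.
- move=> y p y01 hp; split=> q1 q2; rewrite !gt1 => hq1 hq2.
  + exact: sin_q_lt.
  + exact: tamh_q_lt.
- split.
  + exact: cos_p_not_monotonic.
  + exact: cos_q_not_monotonic.
  + exact: cosh_q_not_monotonic.
  + exact: tam_q_not_monotonic.
  + exact: sinh_q_not_monotonic.
Qed.
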